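(* Let $G:\mathcal Q(V)\to\mathbb R$ be a Gårding elliptic polynomial operator of degree $d\ge1$, let $H=G^{\mathrm{top}}$ be its top homogeneous part, and set $\mathcal A=\operatorname{int}\mathcal C_G^{(1)}$. Then the following are equivalent: (1) $(G,\mathcal A)$ is det-elliptic with exponent $d/n$: there exists $\eta>0$ such that $G(A+P)-G(A)\ge\eta\det_\rho(P)^{d/n}$ for every $A\in\mathcal A$ and $P\in\mathcal Q(V)^+$. (2) For some $\eta>0$, $H(P)\ge\eta\det_\rho(P)^{d/n}$ for every $P\in\mathcal Q(V)^+$. (3) $\operatorname{Cap}_{\det}(H)>0$. (4) For every $\rho$-unitary basis $\mathbf v$ of $V$, $\frac dn\mathbf 1\in\operatorname{Newt}(g_{\mathbf v})$. (5) The subspace polymatroid $\mathcal P_H=(V,r_H)$ is slope semistable; equivalently, $r_H(U)\ge\frac dn\dim_{\mathbb C}U$ for every complex subspace $U\subseteq V$. Moreover, the optimal (largest) constant in (1) and (2) is $\eta_{\mathrm{opt}}=\operatorname{Cap}_{\det}(H)$.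
   Context: $V$ is a complex vector space of dimension $n$ with a fixed positive definite Hermitian form $\rho$; $\mathcal Q(V)$ is the real vector space of Hermitian forms on $V$, identified through $\rho$ with Hermitian endomorphisms ($\rho$ corresponds to $I$); $\mathcal Q(V)^+$, $\mathcal Q(V)^{++}$ are the semipositive and positive definite forms; $\det_\rho$ is the determinant relative to $\rho$ (product of $\rho$-eigenvalues). Gårding elliptic operators. Let $W$ be a finite-dimensional real vector space and $\mathcal K\subsetneq W$ a closed convex cone with nonempty interior. $\partial_PF$ is the directional derivative of $F$ along $P$. A set $\mathcal U\subseteq W$ satisfies the $\mathcal K$-conic ray test if $\mathcal U+\mathcal K\subseteq\mathcal U$. For a nonzero $F\in\mathbb R[W]$, $\{F>0\}$ has at most one connected component satisfying the $\mathcal K$-conic ray test; if it exists it is denoted $\mathcal C_F^{\mathcal K}$ (for a positive constant $F$, $\mathcal C_F^{\mathcal K}=W$). A nonzero $F$ is $\mathcal K$-Gårding (recursively on degree) if $\mathcal C_F^{\mathcal K}$ exists and, whenever $\deg F\ge1$, for every $P\in\mathcal K$ with $\partial_PF\not\equiv0$ the polynomial $\partial_PF$ is $\mathcal K$-Gårding and $\mathcal C_F^{\mathcal K}\subseteq\mathcal C_{\partial_PF}^{\mathcal K}$. A polynomial $G$ on $\mathcal Q(V)$ is a Gårding elliptic operator if it is $\mathcal Q(V)^+$-Gårding; write $\mathcal C_G=\mathcal C_G^{\mathcal Q(V)^+}$ and $$\mathcal C_G^{(1)}=\bigcap_{P\in\mathcal Q(V)^+,\ \partial_PG\not\equiv0}\mathcal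 C_{\partial_PG}.$$ Determinantal capacity: $\operatorname{Cap}_{\det}(H)=\inf_{P\in\mathcal Q(V)^{++}}H(P)/\det_\rho(P)^{d/n}$. For a $\rho$-unitary basis $\mathbf v=(v_1,\dots,v_n)$, $g_{\mathbf v}(x)=H\bigl(\sum_{i=1}^n x_i\,v_i\otimes\overline{v_i}\bigr)$, where $v_i\otimes\overline{v_i}$ is the rank-one form corresponding to the $\rho$-orthogonal projection onto $\mathbb Cv_i$. $\operatorname{Newt}(g)$ is the convex hull of the exponents of the monomials occurring in $g$ with nonzero coefficient ($g_{\mathbf v}$ has nonnegative coefficients); $\mathbf 1=(1,\dots,1)$. For a complex subspace $U\subseteq V$, $\pi_U$ is the $\rho$-orthogonal projection onto $U$ and $r_H(U)=\deg_tH(I+t\pi_U)$. $\mathcal P_H$ is slope semistable if for every nonzero proper complex subspace $U\subsetneq V$, $\dim_{\mathbb C}U/r_H(U)\le n/d$, with the convention that the left side is $+\infty$ if $r_H(U)=0$. *)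

(* Defs.v *)
From HB Require Import structures.
From mathcomp Require Import all_boot all_order all_algebra.
From mathcomp Require Import lra.
From mathcomp Require Import sesquilinear complex.
From mathcomp Require Import all_classical all_reals all_analysis.
(* The notations of mpoly clash with those of MathComp-Analysis. *)
From mathcomp Require Import -(notations) mpoly.

Set Implicit Arguments.
Unset Strict Implicit.
Unset Printing Implicit Defensive.

Import Order.TTheory GRing.Theory Num.Theory Num.Def.
Import numFieldNormedType.Exports.

Local Open Scope classical_set_scope.
Local Open Scope ring_scope.

(* R[W] for a finite-dimensional real vector space W: polynomials in the
   coordinates with respect to the basis vbasis {:W}. *)
Definition pol (R : realType) (W : vectType R) := mpoly (\dim {:W}) R.

Definition crd (R : realType) (W : vectType R) (w : W) (i : 'I_(\dim {:W})) : R :=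
  coord (vbasis {:W}) i w.

Definition peval (R : realType) (W : vectType R) (F : pol W) (w : W) : R :=
  meval (crd w) F.

Definition pdeg (R : realType) (W : vectType R) (F : pol W) : nat :=
  (@mmeasure _ R mdeg F).-1.

Definition ptop (R : realType) (W : vectType R) (F : pol W) : pol W :=
  pihomog mdeg (pdeg F) F.

Definition pderiv (R : realType) (W : vectType R) (P : W) (F : pol W) : pol W :=
  \sum_i crd P i *: mderiv i F.

(* W with its usual topology, transported from R^(dim W). *)
Definition vtop (R : realType) (W : vectType R) :=
  initial_topology (passmx.rVof (vbasis {:W})).

Definition ppos (R : realType) (W : vectType R) (F : pol W) : set (vtop W) :=
  [set w | 0 < peval F w].

Definition ray_test (R : realType) (W : vectType R) (K U : set W) : Prop :=
  forall u k, U u -> K k -> U (u + k).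

Definition is_ray_component (R : realType) (W : vectType R)
    (K : set W) (F : pol W) (U : set W) : Prop :=
  (exists2 x, ppos F x & U = connected_component (ppos F) x) /\ ray_test K U.

(* C_F^K, meant for F with a (then unique) component as above; it is empty when
   there is none. *)
Definition ray_component (R : realType) (W : vectType R)
    (K : set W) (F : pol W) : set W :=
  \bigcup_(U in is_ray_component K F) U.

(* The derivatives have smaller degree, so this inductive predicate is the
   recursion on the degree. *)
Inductive garding (R : realType) (W : vectType R) (K : set W) (F : pol W)
    : Prop :=
  Garding of F != 0
    & (exists U, is_ray_component K F U)
    & ((0 < pdeg F)%N -> forall P, K P -> pderiv P F != 0 ->
        garding K (pderiv P F))
    & ((0 < pdeg F)%N -> forall P, K P -> pderiv P F != 0 ->
        ray_component K F `<=` ray_component K (pderiv P F)).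

(* The intersection written C_F^(1) for K = Q(V)^+. *)
Definition ray_component1 (R : realType) (W : vectType R)
    (K : set W) (F : pol W) : set (vtop W) :=
  [set A | forall P, K P -> pderiv P F != 0 -> ray_component K (pderiv P F) A].

(* Q(V): the Hermitian forms on V, identified through rho with the
   rho-self-adjoint endomorphisms; f stands for the form rho (f u) v. *)
Definition selfadj (R : realType) (V : vectType R[i]) (rho : {dot V for conjC})
    : {pred 'End(V)} :=
  fun f => `[< forall u v, rho (f u) v = rho u (f v) >].

Record herm (R : realType) (V : vectType R[i]) (rho : {dot V for conjC}) :=
  Herm { herm_val :> 'End(V); _ : herm_val \in selfadj rho }.

Section HermVect.
Variables (R : realType) (V : vectType R[i]) (rho : {dot V for conjC}).
Local Open Scope complex_scope.

HB.instance Definition _ := [isSub for @herm_val R V rho].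
HB.instance Definition _ := [Choice of herm rho by <:].

Lemma selfadjP (f : 'End(V)) :
  reflect (forall u v, rho (f u) v = rho u (f v)) (f \in selfadj rho).
Proof. exact: asboolP. Qed.

Lemma hermP (f : herm rho) u v : rho (f u) v = rho u (f v).
Proof. exact: (selfadjP _ (valP f)). Qed.

Lemma selfadj_zmod : zmod_closed (selfadj rho).
Proof.
split=> [|f g /selfadjP ff /selfadjP gg]; apply/selfadjP => u v.
  by rewrite !lfunE /= linear0l linear0r.
by rewrite !add_lfunE !opp_lfunE linearBl linearBr /= ff gg.
Qed.

HB.instance Definition _ := GRing.isZmodClosed.Build _ (selfadj rho) selfadj_zmod.
HB.instance Definition _ := [SubChoice_isSubZmodule of herm rho by <:].

Lemma selfadjZ (a : R) (f : herm rho) : a%:C *: herm_val f \in selfadj rho.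
Proof.
apply/selfadjP => u v; rewrite !lfunE /= linearZl_LR linearZr_LR /= hermP.
by congr (_ * _); apply/esym/eqP; rewrite -CrealE complex_real.
Qed.

Definition herm_scale (a : R) (f : herm rho) : herm rho := Herm (selfadjZ a f).

Lemma herm_scaleE a f : herm_val (herm_scale a f) = a%:C *: herm_val f.
Proof. by []. Qed.

Lemma herm_scaleA a b f : herm_scale a (herm_scale b f) = herm_scale (a * b) f.
Proof. by apply/val_inj; rewrite /= scalerA rmorphM. Qed.

Lemma herm_scale1 : left_id 1 herm_scale.
Proof. by move=> f; apply/val_inj; rewrite /= rmorph1 scale1r. Qed.

Lemma herm_scaleDr : right_distributive herm_scale +%R.
Proof. by move=> a f g; apply/val_inj; rewrite /= scalerDr. Qed.

Lemma herm_scaleDl f : {morph herm_scale^~ f : a b / a + b}.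
Proof. by move=> a b; apply/val_inj; rewrite /= rmorphD scalerDl. Qed.

HB.instance Definition _ := GRing.Zmodule_isLmodule.Build R (herm rho)
  herm_scaleA herm_scale1 herm_scaleDr herm_scaleDl.

Local Notation n := (\dim {:V}).
Local Notation e := (vbasis {:V}).

Lemma vbasis_eq0 u : (forall j : 'I_n, rho u e`_j = 0) -> u = 0.
Proof.
move=> u0; apply/eqP; rewrite -(dnorm_eq0 rho).
rewrite [X in rho _ X](coord_vbasis (memvf u)) linear_sumr big1 // => j _.
by rewrite linearZr_LR /= u0 mulr0.
Qed.

Definition gram (f : 'End(V)) : 'M[R[i]]_n := \matrix_(i, j) rho (f e`_i) e`_j.

Lemma gram_linear : linear gram.
Proof.
move=> a f g; apply/matrixP => i j.
by rewrite !mxE add_lfunE scale_lfunE linearDl /= linearZl_LR.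
Qed.

HB.instance Definition _ :=
  GRing.isSemilinear.Build _ _ _ _ gram (GRing.semilinear_linear gram_linear).

Lemma gram_eq0 f : gram f = 0 -> f = 0.
Proof.
move=> /matrixP f0; apply/lfunP => u; rewrite lfunE /=.
rewrite (coord_vbasis (memvf u)) linear_sum big1 // => i _.
rewrite linearZ /= (@vbasis_eq0 (f e`_i)) ?scaler0 // => j.
by have := f0 i j; rewrite !mxE.
Qed.

Lemma gram_surj M : exists f, gram f = M.
Proof.
have k0 : lker (linfun gram) == 0%VS.
  rewrite -subv0; apply/subvP => f; rewrite memv_ker lfunE /= => /eqP /gram_eq0 ->.
  exact: mem0v.
have lf : limg (linfun gram) = fullv.
  apply/eqP; rewrite eqEdim subvf /= limg_dim_eq; last first.
    by rewrite (eqP k0) capv0.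
  by rewrite !dimvf /dim /=.
have : M \in limg (linfun gram) by rewrite lf memvf.
by case/memv_imgP => f _ ->; exists f; rewrite lfunE.
Qed.

(* A Hermitian matrix B + i C, with B symmetric and C antisymmetric, is encoded
   by the arbitrary real matrix B + C. *)
Definition herm_mx (f : herm rho) : 'M[R]_n :=
  \matrix_(i, j) (complex.Re (gram f i j) + complex.Im (gram f i j)).

Lemma herm_mx_linear : linear herm_mx.
Proof.
move=> a f g; apply/matrixP => i j; rewrite !mxE.
have -> : (a *: f + g) e`_i = a%:C *: f e`_i + g e`_i.
  by rewrite /= add_lfunE scale_lfunE.
rewrite linearDl /= linearZl_LR /=.
case: (rho (f _) _) => x y; case: (rho (g _) _) => z t /=.
by rewrite !mul0r subr0 addr0 mulrDr addrACA.
Qed.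

HB.instance Definition _ :=
  GRing.isSemilinear.Build _ _ _ _ herm_mx (GRing.semilinear_linear herm_mx_linear).

Lemma gram_herm (f : herm rho) i j : gram f j i = (gram f i j)^*.
Proof. by rewrite !mxE hermP hermC expr0 mul1r. Qed.

Lemma herm_mx_inj : injective herm_mx.
Proof.
apply: raddf_inj => f /matrixP f0; apply/val_inj/gram_eq0/matrixP => i j.
have := f0 i j; have := f0 j i; rewrite !mxE.
have := gram_herm f i j; rewrite !mxE => ->.
case: (rho (f e`_i) e`_j) => x y /= xy0 xy.
have x0 : x = 0 by lra.
have y0 : y = 0 by lra.
by rewrite x0 y0.
Qed.

Lemma herm_mx_surj A : exists f, herm_mx f = A.
Proof.
have [f fA] := gram_surj
  (\matrix_(i, j) (((A i j + A j i) / 2) +i* ((A i j - A j i) / 2))).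
have fE (i j : 'I_n) :
    rho (f e`_i) e`_j = ((A i j + A j i) / 2) +i* ((A i j - A j i) / 2).
  by have /matrixP/(_ i j) := fA; rewrite !mxE.
have fsa : f \in selfadj rho.
  have fe u (j : 'I_n) : rho (f u) e`_j = rho u (f e`_j).
    rewrite (coord_vbasis (memvf u)) linear_sum /= !(linear_sumlz rho).
    apply: eq_bigr => i _; rewrite linearZ /= !linearZl_LR /=; congr (_ * _).
    have -> : rho e`_i (f e`_j) = (rho (f e`_j) e`_i)^*.
      by rewrite [LHS](hermC rho) expr0 mul1r.
    rewrite [LHS]fE [in RHS]fE.
    by apply/eqP; rewrite eq_complex /= (addrC (A j i)) -mulNr opprB !eqxx.
  apply/selfadjP => u v; rewrite (coord_vbasis (memvf v)) (linear_sum f) /=.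
  rewrite !(linear_sumr rho); apply: eq_bigr => j _.
  by rewrite [f (_ *: _)]linearZ /= !linearZr_LR /= fe.
exists (Herm fsa); apply/matrixP => i j; rewrite !mxE /= fE /=.
by lra.
Qed.

Lemma herm_vect_axiom : vector_axiom_def (n * n) (herm rho).
Proof.
exists (mxvec \o herm_mx); first by move=> a f g /=; rewrite !linearP.
apply: bij_comp; first exact: (Bijective mxvecK vec_mxK).
have [g gK] := choice herm_mx_surj.
by exists g => // f; apply: herm_mx_inj.
Qed.

HB.instance Definition _ := Lmodule_hasFinDim.Build R (herm rho) herm_vect_axiom.

End HermVect.

Section HermOps.
Variables (R : realType) (V : vectType R[i]) (rho : {dot V for conjC}).
Local Open Scope complex_scope.

Lemma selfadj1 : \1%VF \in selfadj rho.
Proof. by apply/selfadjP => u v; rewrite !id_lfunE. Qed.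

Definition herm1 : herm rho := Herm selfadj1.

Definition rank1_fun (v u : V) : V := rho u v *: v.

Lemma rank1_fun_linear v : linear (rank1_fun v).
Proof.
by move=> a x y; rewrite /rank1_fun linearDl /= linearZl_LR /= scalerDl scalerA.
Qed.

HB.instance Definition _ v := GRing.isSemilinear.Build _ _ _ _ (rank1_fun v)
  (GRing.semilinear_linear (rank1_fun_linear v)).

Lemma selfadj_rank1 v : linfun (rank1_fun v) \in selfadj rho.
Proof.
apply/selfadjP => x y; rewrite !lfunE /= /rank1_fun linearZl_LR linearZr_LR /=.
by rewrite (hermC rho v y) expr0 mul1r mulrC.
Qed.

(* v (x) \bar v, the form (u, w) |-> rho u v * rho v w. *)
Definition rank1 (v : V) : herm rho := Herm (selfadj_rank1 v).

Lemma orthov_cap (U : {vspace V}) : (U :&: orthov rho U = 0)%VS.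
Proof.
apply/eqP; rewrite -subv0; apply/subvP => u /memv_capP[uU /mem_orthovP uo].
by rewrite memv0 -(dnorm_eq0 rho) uo.
Qed.

Lemma orthov_add (U : {vspace V}) : (U + orthov rho U = fullv)%VS.
Proof.
apply/eqP; rewrite eqEsubv subvf /=; apply/subvP => u _.
have [x xU [y [-> _ yo]]] := orthogonal_split rho (vbasis U) u.
rewrite (span_basis (vbasisP U)) in xU; apply: memv_add => //.
apply/mem_orthovP => v vU; apply: (span_orthogonal yo).
  exact: memv_span1.
by rewrite (span_basis (vbasisP U)).
Qed.

Lemma selfadj_split (p q : 'End(V)) : (forall u, p u + q u = u) ->
  (forall u v, rho (q u) (p v) = 0) -> p \in selfadj rho.
Proof.
move=> pq po; have op u v : rho (p u) (q v) = 0.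
  by apply/eqP; rewrite (herm_eq0C rho); apply/eqP; exact: po.
apply/selfadjP => u v.
have -> : rho (p u) v = rho (p u) (p v).
  by rewrite -{1}(pq v) (linearDr rho) [X in _ + X]op addr0.
by rewrite -{2}(pq u) (linearDl rho) [X in _ + X]po addr0.
Qed.

Lemma selfadj_proj (U : {vspace V}) :
  daddv_pi U (orthov rho U) \in selfadj rho.
Proof.
apply: (@selfadj_split _ (daddv_pi (orthov rho U) U)) => [u|u v].
  by apply: daddv_pi_add; rewrite ?orthov_cap // orthov_add memvf.
have /mem_orthovP := memv_pi (orthov rho U) U u; apply; exact: memv_pi.
Qed.

(* pi_U, defined as the projection onto U along its rho-orthogonal. *)
Definition orth_proj (U : {vspace V}) : herm rho := Herm (selfadj_proj U).

Definition psd : set (herm rho) := [set P | forall v, 0 <= rho (P v) v].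

Definition posdef : set (herm rho) :=
  [set P | forall v, v != 0 -> 0 < rho (P v) v].

(* The determinant of a self-adjoint endomorphism is real. *)
Definition det_rho (P : herm rho) : R :=
  complex.Re (\det (passmx.mxof (vbasis {:V}) (vbasis {:V}) (herm_val P))).

Definition garding_elliptic (G : pol (herm rho)) : Prop := garding psd G.

Definition det_elliptic (G : pol (herm rho)) (A : set (herm rho)) (a eta : R)
    : Prop :=
  forall (B P : herm rho), A B -> psd P ->
    eta * det_rho P `^ a <= peval G (B + P) - peval G B.

Definition det_bounded (H : pol (herm rho)) (a eta : R) : Prop :=
  forall P : herm rho, psd P -> eta * det_rho P `^ a <= peval H P.

Definition cap_det (H : pol (herm rho)) (a : R) : \bar R :=
  ereal_inf [set (peval H P / det_rho P `^ a)%:E | P in posdef].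

Definition unitary_basis n (v : n.-tuple V) : bool :=
  basis_of {:V} v && orthonormal rho v.

(* g_v as a polynomial: H with the j-th coordinate variable replaced by the j-th
   coordinate of \sum_i x_i v_i (x) \bar v_i. *)
Definition basis_restr n (v : n.-tuple V) (H : pol (herm rho)) : mpoly n R :=
  comp_mpoly
    [tuple \sum_(i < n) crd (rank1 (tnth v i)) j *: mpolyX R (mnm1 i) | j < _] H.

(* H (1 + t orth_proj U) as a polynomial in t. *)
Definition subspace_restr (U : {vspace V}) (H : pol (herm rho)) : {poly R} :=
  mmap (@polyC R) (fun j => (crd herm1 j)%:P + crd (orth_proj U) j *: 'X) H.

Definition subspace_rank (H : pol (herm rho)) (U : {vspace V}) : nat :=
  (size (subspace_restr U H)).-1.

Definition slope (H : pol (herm rho)) (U : {vspace V}) : \bar R :=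
  if subspace_rank H U == 0%N then +oo%E
  else ((\dim U)%:R / (subspace_rank H U)%:R)%:E.

Definition slope_semistable (H : pol (herm rho)) (d : nat) : Prop :=
  forall U : {vspace V}, U != 0%VS -> U != {:V}%VS ->
    (slope H U <= ((\dim {:V})%:R / d%:R)%:E)%E.

End HermOps.

Arguments herm1 {R V} rho.
Arguments orth_proj {R V} rho U.
Arguments psd {R V} rho.
Arguments posdef {R V} rho.

Definition newton (R : realType) n (g : mpoly n R) : set 'rV[R]_n :=
  smallest (@convex_set R 'rV[R]_n)
    [set \row_(i < n) (m i)%:R | m in [set` msupp g]].

Definition largest (R : realType) (S : set R) (c : R) : Prop := S c /\ ubound S c.

(* Main.v *)
Require Import Defs.
From HB Require Import structures.
From mathcomp Require Import all_boot all_order all_algebra.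
From mathcomp Require Import ring lra zify.
From mathcomp Require Import sesquilinear complex.
From mathcomp Require Import all_classical all_reals all_analysis.
From mathcomp Require Import -(notations) mpoly.
From mathcomp Require spectral polyrcf.

(** Write [H = ptop G] and, for directions [P_1, ..., P_d],
    [mixed G [P_1, ..., P_d]] for the constant obtained by differentiating [G]
    successively along them: this is [d!] times the polarization of [H]. Two
    facts about it follow from the definition of a Garding polynomial. It is
    nonnegative on semipositive forms, because the successive derivatives are
    zero or positive on the component of [G]. It satisfies the
    Alexandrov-Fenchel inequality ([garding_AF]): after [d - 2] derivatives a
    quadratic Garding polynomial [F] is left; were it positive on a whole line
    of semipositive direction [P] through its component, that line would stay
    in the component, where [pderiv P F] is positive, although it is affine and
    changes sign along the line. So the discriminant along such lines is
    nonnegative, and letting the base point go to infinity in a second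
    direction yields the inequality.

    From these two facts alone comes an exchange property ([mixed_augment]): if
    the word [u] has a positive mixed value, completed by [I], and so has the
    power of [Q] of length [size u + 1], where [Q] dominates the letters of
    [u], then [Q] can be added to [u]. Hence a greedy choice along a chain
    [Q_0 <= ... <= Q_(n-1)] ([mixed_greedy]): if [Q_k] has rank at least
    [(d / n) (k + 1)] for every [k], then the word of length [d] with letters
    [Q_(floor (i n / d))] has positive mixed value. Under slope semistability
    this applies to the partial sums of every unitary basis.

    Greedy words give both consequences of semistability. Sort the eigenvalues
    [x_0 >= ... >= x_(n-1)] of a positive form [P] and let [Q_k] be the
    projection onto the first [k + 1] eigenlines; as [P >= x_k Q_k], [d! H P]
    is at least the mixed value of the greedy word times the product of the
    [x_(floor (i n / d))], which is at least [det P ^ (d / n)]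
    ([level_average]). The flags form a compact set, so these mixed values are
    bounded below and [H] dominates a multiple of [det ^ (d / n)]
    ([semistable_det_bounded]). On the other hand, expanding the greedy word of
    the flag sorted by a weight [w] yields an exponent of [g_v] on which [w] is
    at least its mean times [d]; no hyperplane separates [(d / n) 1] from the
    Newton polytope ([semistable_newton]).

    The remaining implications are direct. Testing the determinant bound on
    [I + t pi_U] for large [t], or a facet inequality of the Newton polytope on
    a basis adapted to [U], gives back the slope inequality. By Taylor's
    formula [G (A + P) - G A] is the sum of [H P] and nonnegative terms, and
    [H P] is its leading coefficient in the direction [P]; so the constants
    allowed in the first two conditions coincide, and both are those below the
    capacity. *)

Set Implicit Arguments.
Unset Strict Implicit.
Unset Printing Implicit Defensive.

Import Order.TTheory GRing.Theory Num.Theory Num.Def.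
Import numFieldNormedType.Exports.

Local Open Scope classical_set_scope.
Local Open Scope ring_scope.

(** * Directional derivatives of polynomials *)

Section Calculus.
Variables (R : realType) (W : vectType R).
Implicit Types (F G : pol W) (P Q w : W) (u : seq W).

Lemma crdD P Q i : crd (P + Q) i = crd P i + crd Q i.
Proof. by rewrite /crd linearD. Qed.

Lemma crdZ a P i : crd (a *: P) i = a * crd P i.
Proof. by rewrite /crd linearZ. Qed.

Lemma crd0 i : crd (0 : W) i = 0.
Proof. by rewrite /crd linear0. Qed.

Lemma crd_basis (i j : 'I_(\dim {:W})) : crd (vbasis {:W})`_i j = (i == j)%:R.
Proof. by rewrite /crd coord_free ?(basis_free (vbasisP _)). Qed.

Lemma crd_sum w : w = \sum_i crd w i *: (vbasis {:W})`_i.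
Proof. exact: coord_vbasis (memvf w). Qed.

Lemma pderiv_is_linear P : linear (@pderiv R W P).
Proof.
move=> a F G; rewrite /pderiv scaler_sumr -big_split /=.
by apply: eq_bigr => i _; rewrite linearP /= scalerDr !scalerA mulrC.
Qed.

HB.instance Definition _ P := GRing.isSemilinear.Build R (pol W) (pol W) _
  (pderiv P) (GRing.semilinear_linear (pderiv_is_linear P)).

Lemma pderivDl P Q F : pderiv (P + Q) F = pderiv P F + pderiv Q F.
Proof. by rewrite -big_split; apply: eq_bigr => i _; rewrite crdD scalerDl. Qed.

Lemma pderivZl a P F : pderiv (a *: P) F = a *: pderiv P F.
Proof. by rewrite scaler_sumr; apply: eq_bigr => i _; rewrite crdZ scalerA. Qed.

Lemma pderiv_comm P Q F : pderiv P (pderiv Q F) = pderiv Q (pderiv P F).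
Proof.
rewrite /pderiv.
under eq_bigr => i _ do rewrite (linear_sum (mderiv i)) /= scaler_sumr.
under [RHS]eq_bigr => i _ do rewrite (linear_sum (mderiv i)) /= scaler_sumr.
rewrite exchange_big /=; apply: eq_bigr => i _; apply: eq_bigr => j _.
by rewrite !linearZ /= mderiv_comm !scalerA mulrC.
Qed.

Lemma pderiv_basis (i : 'I_(\dim {:W})) F : pderiv (vbasis {:W})`_i F =
  mderiv i F.
Proof.
rewrite /pderiv (bigD1 i) //= crd_basis eqxx scale1r big1 ?addr0 // => j.
by rewrite eq_sym crd_basis => /negPf ->; rewrite scale0r.
Qed.

Lemma mcoeff_pderiv P F m :
  mcoeff m (pderiv P F) =
    \sum_i crd P i * (mcoeff (mnm_add m (mnm1 i)) F *+ (m i).+1).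
Proof.
rewrite /pderiv raddf_sum; apply: eq_bigr => i _ /=.
by rewrite mcoeffZ mcoeff_mderiv.
Qed.

(** The chain rule, in a form that covers restriction to a line ([delta] the
    derivation of [{poly R}]) and to a span ([delta] a partial derivative): two
    derivations that agree on constants and variables are equal. *)
Lemma mmap_pderiv (S : comNzRingType) (f : {rmorphism R -> S})
    (h : 'I_(\dim {:W}) -> S) (delta : {additive S -> S}) P F :
  (forall a b, delta (a * b) = delta a * b + a * delta b) ->
  (forall c, delta (f c) = 0) -> (forall j, delta (h j) = f (crd P j)) ->
  delta (mmap f h F) = mmap f h (pderiv P F).
Proof.
move=> dM dC dh.
pose good (F : pol W) := delta (mmap f h F) = mmap f h (pderiv P F).
have pM F1 F2 : pderiv P (F1 * F2 : pol W) =
  pderiv P F1 * F2 + F1 * pderiv P F2.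
  rewrite /pderiv mulr_suml mulr_sumr -big_split; apply: eq_bigr => i _ /=.
  by rewrite mderivM scalerDr -scalerAl -scalerAr.
have goodM F1 F2 : good F1 -> good F2 -> good (F1 * F2 : pol W).
  by rewrite /good => g1 g2; rewrite pM rmorphD !rmorphM dM g1 g2.
have goodC c : good (mpolyC _ c).
  rewrite /good mmapC dC /pderiv big1 ?mmap0 // => i _.
  by rewrite mderivC scaler0.
have goodX i : good (mpolyX _ (mnm1 i)).
  rewrite /good mmapX mmap1U dh /pderiv (bigD1 i) //= big1 => [|j /negPf ji].
    rewrite addr0 mderivX mnm1E eqxx scale1r (_ : mnm_sub _ _ = mnm0);
      first by rewrite mpolyX0 mmapZ rmorph1 mulr1.
    by apply/mnmP => k; rewrite mnmBE subnn mnm0E.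
  by rewrite mderivX mnm1E eq_sym ji scale0r scaler0.
elim/mpolyind: F => [|c m F _ _ gF]; first by rewrite !raddf0.
rewrite !raddfD /= gF; congr (_ + _); rewrite -mul_mpolyC.
apply: (goodM _ _); first exact: goodC.
rewrite mpolyXE_id; elim/big_ind: _ => [|x y|i _]; first exact: (goodC 1).
  exact: (goodM _ _).
by elim: (m i) => [|k IH]; [exact: (goodC 1)|rewrite exprS; exact: (goodM _ _)].
Qed.

End Calculus.

(** * Restriction of polynomials to lines and to spans *)

Section Lines.
Variables (R : realType) (W : vectType R).
Implicit Types (F G : pol W) (P Q w : W) (u : seq W).

Definition line w P F : {poly R} :=
  mmap (@polyC R) (fun j => (crd w j)%:P + crd P j *: 'X) F.

Lemma horner_line w P F t : (line w P F).[t] = peval F (w + t *: P).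
Proof.
rewrite /line /peval mevalE /mmap horner_sum; apply: eq_bigr => m _.
rewrite hornerM hornerC; congr (_ * _); rewrite /mmap1 horner_prod.
apply: eq_bigr => i _; rewrite horner_exp !hornerE crdD crdZ mulrC.
by congr ((_ + _) ^+ _); rewrite mulrC.
Qed.

Lemma deriv_line w P F : (line w P F)^`() = line w P (pderiv P F).
Proof.
apply: (@mmap_pderiv _ _ _ (@polyC R) _ (@deriv R)) => [a b|c|j].
- by rewrite /= derivM.
- by rewrite /= derivC.
- by rewrite /= derivD derivC derivZ derivX add0r alg_polyC.
Qed.

Lemma line_coef w P F k :
  (line w P F)`_k *+ k`! = peval (iter k (pderiv P) F) w.
Proof.
have dE : (line w P F)^`(k) = line w P (iter k (pderiv P) F).
  by elim: k => //= k IH; rewrite -[LHS]/(_^`()) IH deriv_line.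
have := coef_derivn k (line w P F) 0.
rewrite addn0 ffactnn dE => <-.
by rewrite -horner_coef0 horner_line scale0r addr0.
Qed.

(** Stated on coefficients, so that [deg_lt 0] is available for the zero
    polynomial. *)
Definition deg_lt (k : nat) F := forall m, (k <= mdeg m)%N -> mcoeff m F = 0.

Lemma deg_lt_pdeg F k : (pdeg F < k)%N -> deg_lt k F.
Proof.
move=> Fk m km; apply: memN_msupp_eq0; apply: msize_mdeg_ge.
apply: leq_trans km; apply: leq_trans Fk; exact: leqSpred.
Qed.

Lemma pdeg_coef F k : F != 0 -> pdeg F = k ->
  exists2 m, mdeg m = k & mcoeff m F != 0.
Proof.
move=> F0 <-; exists (mlead F); last by rewrite mleadc_eq0.
by rewrite /pdeg -(mlead_deg F0).
Qed.

Lemma deg_lt0 F : deg_lt 0 F -> F = 0.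
Proof. by move=> F0; apply/mpolyP => m; rewrite F0 // mcoeff0. Qed.

Lemma peval_const F w : deg_lt 1 F -> peval F w = mcoeff mnm0 F.
Proof.
move=> F1; suff -> : F = mpolyC _ (mcoeff mnm0 F).
  by rewrite /peval mevalC mpolyCK.
apply/mpolyP => m; rewrite mcoeffC; have [->|m0] := eqVneq m mnm0.
  by rewrite mulr1.
by rewrite mulr0 F1 // lt0n mdeg_eq0.
Qed.

Lemma deg_lt_pderiv P F k : deg_lt k.+1 F -> deg_lt k (pderiv P F).
Proof.
move=> Fk m km; rewrite mcoeff_pderiv big1 // => i _.
by rewrite Fk ?mul0rn ?mulr0 // mdegD mdeg1 addn1.
Qed.

Lemma pderiv_const P F : deg_lt 1 F -> pderiv P F = 0.
Proof. by move=> F1; apply/deg_lt0/deg_lt_pderiv. Qed.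

Definition pderivs u F := foldr (@pderiv R W) F u.

Lemma pderivs_cat u v F : pderivs (u ++ v) F = pderivs u (pderivs v F).
Proof. exact: foldr_cat. Qed.

Lemma pderivs_nseq k P F : pderivs (nseq k P) F = iter k (pderiv P) F.
Proof. by elim: k => //= k ->. Qed.

Lemma deg_lt_pderivs u F k : deg_lt (size u + k) F -> deg_lt k (pderivs u F).
Proof.
elim: u k => //= P u IH k Fk; apply: deg_lt_pderiv; apply: IH.
by rewrite addnS -addSn.
Qed.

Lemma pderivs0 u : pderivs u 0 = 0.
Proof. by elim: u => //= P u ->; rewrite linear0. Qed.

Lemma perm_pderivs u v F : perm_eq u v -> pderivs u F = pderivs v F.
Proof.
move=> uv; pose same s := pderivs u F = pderivs s F.
apply: (@catCA_perm_ind _ same _ _ _ uv) => // u1 u2 u3; rewrite /same => ->.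
rewrite !pderivs_cat; elim: u2 => //= P u2 <-; elim: u1 => //= Q u1 ->.
exact: pderiv_comm.
Qed.

Lemma pderivsB u F G : pderivs u (F - G) = pderivs u F - pderivs u G.
Proof. by elim: u => //= P u ->; rewrite linearB. Qed.

Lemma mcoeff_pihomog k F m :
  mcoeff m (pihomog mdeg k F) = if mdeg m == k then mcoeff m F else 0.
Proof.
rewrite /pihomog linear_sum /=.
under eq_bigr do rewrite mcoeffZ mcoeffX.
have [mk|mk] := ifPn; last first.
  rewrite big1 // => j /eqP jk; case: eqP => [jm|_]; last by rewrite mulr0.
  by rewrite -jk jm eqxx in mk.
have [mF|mF] := boolP (m \in msupp F); last first.
  rewrite (memN_msupp_eq0 mF) big_seq_cond big1 // => j /andP[jF _].
  by case: eqP => [jm|_]; [rewrite -jm jF in mF|rewrite mulr0].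
rewrite (big_rem m) //= mk eqxx mulr1 big_seq_cond big1 ?addr0 // => j /andP[].
rewrite mem_rem_uniq ?msupp_uniq // => /andP[/negPf jm _] _.
by rewrite jm mulr0.
Qed.

Definition homog (k : nat) F := forall m, mdeg m != k -> mcoeff m F = 0.

Lemma homog_ptop F : homog (pdeg F) (ptop F).
Proof. by move=> m /negPf mk; rewrite mcoeff_pihomog mk. Qed.

Lemma homog_deg_lt k F : homog k F -> deg_lt k.+1 F.
Proof. by move=> Fk m km; rewrite Fk // gtn_eqF. Qed.

Lemma homog_pderiv P k F : homog k.+1 F -> homog k (pderiv P F).
Proof.
move=> Fk m km; rewrite mcoeff_pderiv big1 // => i _.
by rewrite Fk ?mul0rn ?mulr0 // mdegD mdeg1 addn1.
Qed.

Lemma homog_pderivs u k F : homog (size u + k) F -> homog k (pderivs u F).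
Proof.
elim: u k => //= P u IH k Fk; apply/homog_pderiv/IH.
by rewrite addnS -addSn.
Qed.

Lemma pderivs_ptop u F : size u = pdeg F -> pderivs u (ptop F) = pderivs u F.
Proof.
move=> uF; apply/eqP; rewrite eq_sym -subr_eq0 -pderivsB; apply/eqP/deg_lt0.
apply: deg_lt_pderivs; rewrite addn0 uF => m Fm.
rewrite mcoeffB mcoeff_pihomog; case: eqP => [_|/eqP mF];
  first by rewrite subrr.
rewrite subr0; apply: deg_lt_pdeg (leqnn _) _ _.
by rewrite ltn_neqAle eq_sym mF.
Qed.

(** The restriction to a line through the origin is a monomial. *)
Lemma homog_coef_line k F w : homog k F -> (line 0 w F)`_k = peval F w.
Proof.
move=> Fk; suff -> : line 0 w F = peval F w *: 'X^k.
  by rewrite coefZ coefXn eqxx mulr1.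
rewrite /line /peval mevalE scaler_suml /mmap; apply: eq_big_seq => m mF.
have mk : mdeg m = k.
  by apply/eqP/negPn/negP => /Fk m0; rewrite mcoeff_msupp m0 eqxx in mF.
rewrite -scalerA -mul_polyC; congr (_ * _); rewrite /mmap1 -mk mdegE.
rewrite -prodrXr -scaler_prod; apply: eq_bigr => i _.
by rewrite crd0 add0r exprZn.
Qed.

Lemma peval_homog k F w : homog k F ->
  peval F w *+ k`! = peval (iter k (pderiv w) F) 0.
Proof. by move=> Fk; rewrite -(homog_coef_line _ Fk) line_coef. Qed.

Lemma peval_homog0 k F : homog k.+1 F -> peval F 0 = 0.
Proof.
move=> Fk; rewrite /peval mevalE big_seq big1 // => m mF.
have mk : mdeg m = k.+1.
  by apply/eqP/negPn/negP => /Fk m0; rewrite mcoeff_msupp m0 eqxx in mF.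
have [i mi] : exists i, m i != 0%N.
  apply/existsP; apply: contraT; rewrite negb_exists => /forallP m0.
  move: mk; rewrite mdegE big1 // => i _; apply/eqP.
  by have := m0 i; rewrite negbK.
by rewrite (bigD1 i) //= crd0 expr0n (negPf mi) mul0r mulr0.
Qed.

End Lines.

Section Restriction.
Variables (R : realType) (W : vectType R) (n : nat).
Implicit Types (F : pol W) (g : mpoly n R) (l : seq 'I_n).

Definition word_mnm l : multinom n := Multinom [tuple count_mem i l | i < n].

Lemma mdeg_word_mnm l : mdeg (word_mnm l) = size l.
Proof.
rewrite mdegE; under eq_bigr do rewrite mnmE.
elim: l => [|i l IH] /=; first by rewrite big1.
rewrite big_split /= IH (bigD1 i) //= eqxx big1 ?addn0 // => j /negPf.
by rewrite eq_sym => ->.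
Qed.

(** Words stand for monomials, since derivatives are taken one letter at a
    time. *)
Lemma word_mnmP (m : multinom n) : exists l, word_mnm l = m.
Proof.
exists (flatten [seq nseq (m i) i | i <- index_enum (ordinal n)]).
apply/mnmP => j; rewrite mnmE count_flatten sumnE !big_map.
rewrite (bigD1 j) //= count_nseq /= eqxx mul1n big1 ?addn0 // => i /negPf ij.
by rewrite count_nseq /= ij mul0n.
Qed.

Lemma mcoeff_mderivs g l m : exists2 c : nat, (0 < c)%N &
  mcoeff m (foldr (@mderiv n R) g l) = mcoeff (mnm_add m (word_mnm l)) g *+ c.
Proof.
elim: l m => [|i l IH] m /=.
  exists 1%N => //; rewrite mulr1n; congr mcoeff.
  by apply/mnmP => j; rewrite mnmDE mnmE addn0.
have [c c0 cE] := IH (mnm_add m (mnm1 i)).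
exists (c * (m i).+1)%N; first by rewrite muln_gt0 c0.
have -> : mnm_add m (word_mnm (i :: l)) =
    mnm_add (mnm_add m (mnm1 i)) (word_mnm l).
  by apply/mnmP => j; rewrite !mnmDE !mnmE /= addnA.
by rewrite mcoeff_mderiv cE mulrnA.
Qed.

Definition restr (E : 'I_n -> W) F : mpoly n R :=
  comp_mpoly [tuple \sum_(i < n) crd (E i) j *: mpolyX R (mnm1 i) | j < _] F.

Lemma mderiv_restr E F i : mderiv i (restr E F) = restr E (pderiv (E i) F).
Proof.
apply: (@mmap_pderiv _ _ _ (@mpolyC n R) _ (@mderiv n R i)) => [a b|c|j].
- by rewrite /= mderivM.
- by rewrite /= mderivC.
rewrite /= tnth_mktuple (linear_sum (mderiv i))
  (bigD1 i) //= big1 => [|k /negPf ki].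
  rewrite linearZ /= mderivX mnm1E eqxx scale1r addr0.
  rewrite (_ : mnm_sub _ _ = mnm0) ?mpolyX0 ?alg_mpolyC //.
  by apply/mnmP => k; rewrite mnmBE subnn mnm0E.
by rewrite linearZ /= mderivX mnm1E ki scale0r scaler0.
Qed.

Lemma mderivs_restr E F l :
  foldr (@mderiv n R) (restr E F) l = restr E (pderivs (map E l) F).
Proof. by elim: l => //= i l ->; rewrite mderiv_restr. Qed.

Lemma mcoeff0_restr E F : mcoeff mnm0 (restr E F) = peval F 0.
Proof.
rewrite /restr /comp_mpoly /mmap linear_sum /= /peval mevalE.
apply: eq_bigr => m _; rewrite mcoeffCM; congr (_ * _).
rewrite /mmap1 rmorph_prod /=; apply: eq_bigr => i _.
rewrite rmorphXn /= tnth_mktuple linear_sum /= big1 ?crd0 // => j _.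
rewrite mcoeffZ mcoeffX (_ : (_ == _) = false) ?mulr0 //.
by apply/negP => /eqP /mnmP /(_ j); rewrite mnm1E eqxx mnm0E.
Qed.

Lemma mcoeff_restr E F l : exists2 c : nat, (0 < c)%N &
  mcoeff (word_mnm l) (restr E F) *+ c = peval (pderivs (map E l) F) 0.
Proof.
have [c c0 cE] := mcoeff_mderivs (restr E F) l mnm0.
exists c => //; rewrite -(mcoeff0_restr E) -mderivs_restr cE.
have -> : mnm_add mnm0 (word_mnm l) = word_mnm l; last by [].
by apply/mnmP => j; rewrite mnmDE mnm0E.
Qed.

End Restriction.

(** * Mixed forms on a cone *)

(** Closes the equations between multiplicities to which [permP] reduces the
    reordering of words. *)
Ltac count_words :=
  rewrite /= ?(count_cat, count_nseq) /= ?(count_cat, count_nseq) /=;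
  repeat match goal with |- context [nat_of_bool (?p ?x)] => case: (p x) end;
  rewrite ?(mul1n, mul0n); lia.

Section MixedForms.
Variables (R : realFieldType) (W : lmodType R) (K : set W) (e : W) (d : nat).
Variable M : seq W -> R.
Implicit Types (P Q : W) (u v w : seq W).

Definition all_in u := forall P, P \in u -> K P.

(** The two properties of mixed derivatives on which all combinatorics rests,
    nonnegativity and the Alexandrov-Fenchel inequality, together with
    multilinearity and symmetry for words of length [d]. *)
Record mixed_form : Prop := MixedForm {
  coneD : forall P Q, K P -> K Q -> K (P + Q);
  coneZ : forall a P, 0 <= a -> K P -> K (a *: P);
  cone_unit : K e;
  mixed_perm : forall u v, perm_eq u v -> M u = M v;
  mixedD : forall P Q u, M (P + Q :: u) = M (P :: u) + M (Q :: u);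
  mixedZ : forall a P u, M (a *: P :: u) = a * M (P :: u);
  mixed_ge0 : forall u, size u = d -> all_in u -> 0 <= M u;
  mixed_AF : forall P Q u, (size u).+2 = d -> K P -> K Q -> all_in u ->
    M [:: P, P & u] * M [:: Q, Q & u] <= M [:: P, Q & u] ^+ 2 }.

Hypothesis mf : mixed_form.

Lemma all_in_cons P u : K P -> all_in u -> all_in (P :: u).
Proof. by move=> KP Ku Q; rewrite inE => /orP[/eqP->|/Ku]. Qed.

Lemma all_in_cat u v : all_in u -> all_in v -> all_in (u ++ v).
Proof. by move=> Ku Kv Q; rewrite mem_cat => /orP[/Ku|/Kv]. Qed.

Lemma all_in_nseq k P : K P -> all_in (nseq k P).
Proof. by move=> KP Q; rewrite mem_nseq => /andP[_ /eqP->]. Qed.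

Lemma all_in_sub u v : {subset v <= u} -> all_in u -> all_in v.
Proof. by move=> vu Ku P /vu/Ku. Qed.

Lemma mixed_mono1 P Q u : (size u).+1 = d -> all_in u -> K (Q - P) ->
  M (P :: u) <= M (Q :: u).
Proof.
move=> ud Ku QP; rewrite -[Q](subrK P) (mixedD mf) lerDr.
by apply: (mixed_ge0 mf); rewrite /= ?ud //; apply: all_in_cons.
Qed.

Lemma mixed_mono u v w : size u = size v -> (size u + size w)%N = d ->
  all_in u -> all_in v -> all_in w ->
  (forall i, (i < size u)%N -> K (nth 0 v i - nth 0 u i)) ->
  M (u ++ w) <= M (v ++ w).
Proof.
elim: u v w => [|P u IH] [|Q v] w //= [uv] ud Ku Kv Kw uvle.
have KQ : K Q by apply: Kv; rewrite inE eqxx.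
have {}Kv : all_in v by apply: all_in_sub Kv => x xv; rewrite inE xv orbT.
have {}Ku : all_in u by apply: all_in_sub Ku => x xu; rewrite inE xu orbT.
apply: (@le_trans _ _ (M (Q :: u ++ w))).
  apply: mixed_mono1; [by rewrite size_cat|exact: all_in_cat|exact: (uvle 0%N)].
have swap x : M (Q :: x ++ w) = M (x ++ Q :: w).
  by apply: (mixed_perm mf);
    rewrite perm_sym -cat_rcons -cats1 -catA perm_catCA.
rewrite !swap; apply: IH => //=; first by rewrite addnS.
  exact: all_in_cons.
by move=> i iu; apply: (uvle i.+1).
Qed.

(** The form [M [:: x, y & u]] in [x] and [y] is positive at [(Q, Q)]; by the
    Alexandrov-Fenchel inequality it is seminegative on the orthogonal of [Q],
    so a vector [P] of the cone in that orthogonal would be isotropic, hence in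
    the kernel, and orthogonal to [e]. *)
Lemma mixed_connected P Q u : (size u).+2 = d -> K P -> K Q -> all_in u ->
  0 < M [:: Q, Q & u] -> 0 < M [:: P, e & u] -> 0 < M [:: P, Q & u].
Proof.
move=> ud KP KQ Ku qq pe.
have Ke := cone_unit mf.
have pq0 : 0 <= M [:: P, Q & u].
  by apply: (mixed_ge0 mf) => //; do 2!apply: all_in_cons => //.
rewrite lt_neqAle pq0 andbT; apply/negP => /eqP pq.
set eq2 := M [:: e, Q & u] ^+ 2.
have eq2_ge0 : 0 <= eq2 by exact: sqr_ge0.
(* Alexandrov-Fenchel for [P + t e] and [Q], to first order in [t]. *)
have main t : 0 < t -> 2 * (M [:: P, e & u] * M [:: Q, Q & u]) <= t * eq2.
  move=> t0; have KPt : K (P + t *: e).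
    by apply: (coneD mf) => //; apply: (coneZ mf) => //; exact: ltW.
  have := mixed_AF mf ud KPt KQ Ku.
  rewrite !(mixedD mf) !(mixedZ mf) -pq add0r exprMn -/eq2.
  have sw x y : M [:: x, y & u] = M [:: y, x & u].
    apply: (mixed_perm mf); rewrite -[x :: _]/([:: x] ++ [:: y] ++ u).
    by rewrite perm_catCA.
  rewrite !(sw _ (P + _)) !(mixedD mf) !(mixedZ mf) (sw e P).
  have pp0 : 0 <= M [:: P, P & u].
    by apply: (mixed_ge0 mf) => //; do 2!apply: all_in_cons => //.
  have ee0 : 0 <= M [:: e, e & u].
    by apply: (mixed_ge0 mf) => //; do 2!apply: all_in_cons => //.
  set pp := M [:: P, P & u] in pp0 *; set ee := M [:: e, e & u] in ee0 *.
  set pe' := M [:: P, e & u] in pe *; set qq' := M [:: Q, Q & u] in qq *.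
  move=> H; rewrite -(ler_pM2l t0); apply: le_trans (_ : _ <= t ^+ 2 * eq2) _.
    apply: le_trans H.
    have a0 : 0 <= pp * qq' by rewrite mulr_ge0 // ltW.
    have b0 : 0 <= t ^+ 2 * (ee * qq') by rewrite !mulr_ge0 // ?sqr_ge0 // ltW.
    rewrite -subr_ge0.
    rewrite (_ : _ - _ = pp * qq' + t ^+ 2 * (ee * qq')); last by ring.
    exact: addr_ge0.
  by rewrite expr2 -mulrA; exact: lexx.
have pos : 0 < M [:: P, e & u] * M [:: Q, Q & u] by rewrite mulr_gt0.
set c := _ * _ in pos main.
have /main : 0 < c / (eq2 + 1) by rewrite divr_gt0 // ltr_wpDl.
apply/negP; rewrite -ltNge mulrAC -mulrA [ltRHS]mulrC ltr_pM2l //.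
by rewrite ltr_pdivrMr ?ltr_wpDl //; lra.
Qed.

Definition fill u := u ++ nseq (d - size u) e.

(** Replace the letters of the power of [Q] one at a time by those of [u]. When
    the letter [P] is to enter, the form obtained by fixing all other letters
    but two is positive at [(Q, Q)] by induction, and at [(P, e)] because the
    remaining letters of [u] are dominated by [Q]; so it is positive at
    [(P, Q)]. *)
Lemma mixed_augment Q u : (size u < d)%N -> all_in u -> K Q ->
  (forall P, P \in u -> K (Q - P)) ->
  0 < M (fill u) -> 0 < M (fill (nseq (size u).+1 Q)) -> 0 < M (fill (Q :: u)).
Proof.
set a := size u => ad Ku KQ uQ Mu MQ.
have Ke := cone_unit mf.
suff /(_ a (leqnn a)) : forall i, (i <= a)%N ->
    0 < M (take i u ++ nseq (a.+1 - i) Q ++ nseq (d - a.+1) e).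
  rewrite /a take_size subSnn; congr (_ < _); apply: (mixed_perm mf).
  by apply/permP => p; rewrite /fill; count_words.
elim=> [_|i IH ia]; first by move: MQ; rewrite /fill size_nseq take0 subn0.
have {}IH := IH (ltnW ia).
set P := nth 0 u i.
have Pu : P \in u by rewrite mem_nth.
pose v := take i u ++ nseq (a.-1 - i) Q ++ nseq (d - a.+1) e.
have Kt : all_in (take i u) by apply: all_in_sub Ku => x; exact: mem_take.
have Kv : all_in v.
  by apply: all_in_cat => //; apply: all_in_cat; apply: all_in_nseq.
have sv : (size v).+2 = d.
  by rewrite !size_cat !size_nseq size_takel; lia.
have uE : u = take i u ++ P :: drop i.+1 u.
  by rewrite -drop_nth // cat_take_drop.
have : 0 < M [:: P, Q & v].
  apply: mixed_connected => //; first exact: Ku.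
    move: IH; congr (_ < _); apply: (mixed_perm mf); apply/permP => p.
    by rewrite /v; count_words.
  apply: lt_le_trans Mu _.
  pose w := [:: P, e & take i u ++ nseq (d - a.+1) e].
  have -> : M (fill u) = M (drop i.+1 u ++ w).
    apply: (mixed_perm mf); apply/permP => p; rewrite /fill {1}uE /w.
    by rewrite -/a; count_words.
  have -> : M [:: P, e & v] = M (nseq (a.-1 - i) Q ++ w).
    apply: (mixed_perm mf); apply/permP => p; rewrite /w /v.
    by count_words.
  have sd : size (drop i.+1 u) = (a.-1 - i)%N by rewrite size_drop /a; lia.
  apply: mixed_mono.
  - by rewrite sd size_nseq.
  - rewrite sd /w /= size_cat size_nseq size_takel; lia.
  - by apply: all_in_sub Ku => x; exact: mem_drop.
  - exact: all_in_nseq.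
  - apply: all_in_cons; first exact: Ku.
    by apply: all_in_cons => //; apply: all_in_cat => //; exact: all_in_nseq.
  - move=> j; rewrite sd => ja; rewrite nth_nseq ja nth_drop; apply: uQ.
    by apply: mem_nth; rewrite -/a; lia.
congr (_ < _); apply: (mixed_perm mf); apply/permP => p.
by rewrite (take_nth 0 ia) -cats1 -/P /v; count_words.
Qed.

(** The [i]-th letter of a word of length [d] spread evenly over [n] levels;
    the levels up to [k] get the least number of letters that is at least
    [(d / n) (k + 1)]. *)
Definition level n i := (i * n %/ d)%N.

(** The next letter is always the lowest level whose rank allows one more
    letter. *)
Lemma mixed_greedy n (Q : nat -> W) :
  (0 < n)%N ->
  0 < M (nseq d e) ->
  (forall k, (k < n)%N -> K (Q k)) ->
  (forall j k, (j <= k < n)%N -> K (Q k - Q j)) ->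
  (forall k m, (k < n)%N -> (m < d)%N -> (m * n < d * k.+1)%N ->
    0 < M (fill (nseq m.+1 (Q k)))) ->
  0 < M [seq Q (level n i) | i <- iota 0 d].
Proof.
move=> n0 Me KQ Qmono rk.
suff /(_ d (leqnn d)) : forall m, (m <= d)%N ->
    0 < M (fill [seq Q (level n i) | i <- iota 0 m]).
  by rewrite /fill size_map size_iota subnn cats0.
elim=> [_|m IH md]; first by rewrite /fill /= subn0.
have d0 : (0 < d)%N by lia.
have lev i : (i < d)%N -> (level n i < n)%N.
  by move=> id; rewrite /level ltn_divLR // mulnC ltn_pmul2l.
have sz : size [seq Q (level n i) | i <- iota 0 m] = m.
  by rewrite size_map size_iota.
have mem P : P \in [seq Q (level n i) | i <- iota 0 m] ->
    exists2 i, (i < m)%N & P = Q (level n i).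
  by case/mapP => i; rewrite mem_iota => /andP[_ im] ->; exists i.
rewrite -addn1 iotaD map_cat /=.
have -> : M (fill ([seq Q (level n i) | i <- iota 0 m] ++ [:: Q (level n m)])) =
    M (fill (Q (level n m) :: [seq Q (level n i) | i <- iota 0 m])).
  apply: (mixed_perm mf); rewrite /fill !size_cat /= addn1 -cat_cons perm_cat2r.
  by rewrite cats1 perm_rcons.
apply: mixed_augment; rewrite ?sz //.
- by move=> P /mem[i im ->]; apply/KQ/lev/(ltn_trans im).
- exact/KQ/lev.
- move=> P /mem[i im ->]; apply: Qmono; rewrite lev // ?andbT.
  by apply: leq_div2r; rewrite leq_mul2r (ltnW im) orbT.
- by apply: IH; exact: ltnW.
- by apply: rk => //; [exact: lev|rewrite [ltnRHS]mulnC; exact: ltn_ceil].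
Qed.

Lemma mixed_scale (x : nat -> R) (Q : nat -> W) s w :
  M ([seq x k *: Q k | k <- s] ++ w) =
  (\prod_(k <- s) x k) * M ([seq Q k | k <- s] ++ w).
Proof.
elim: s w => [|k s IH] w; first by rewrite big_nil mul1r.
rewrite big_cons /= (mixedZ mf) -mulrA; congr (_ * _).
have mid P u : M (P :: u ++ w) = M (u ++ P :: w).
  by apply: (mixed_perm mf);
    rewrite perm_sym -cat_rcons -cats1 -catA perm_catCA.
by rewrite !mid IH.
Qed.

Lemma mixed_sum (I : Type) (r : seq I) (E : I -> W) u :
  M (\sum_(i <- r) E i :: u) = \sum_(i <- r) M (E i :: u).
Proof.
elim: r => [|i r IH]; last by rewrite !big_cons (mixedD mf) IH.
by rewrite !big_nil -[in LHS](scale0r 0) (mixedZ mf) mul0r.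
Qed.

(** A positive mixed value of sums has a positive term in its expansion. *)
Lemma mixed_select (I : eqType) (r : nat -> seq I) (E : I -> W) s w :
  0 < M ([seq \sum_(i <- r k) E i | k <- s] ++ w) ->
  exists l, [/\ size l = size s, 0 < M ([seq E i | i <- l] ++ w)
    & all2 (fun i k => i \in r k) l s].
Proof.
elim: s w => [|k s IH] w; first by exists [::].
rewrite /= mixed_sum => Msum.
have [i ir Mi] : exists2 i, i \in r k &
    0 < M (E i :: [seq \sum_(i <- r k) E i | k <- s] ++ w).
  apply: contrapT => H; move: Msum; apply/negP; rewrite -leNgt big_seq.
  apply: sumr_le0 => i ir; rewrite leNgt; apply/negP => Mi; apply: H.
  by exists i.
have mid P u : M (P :: u ++ w) = M (u ++ P :: w).
  by apply: (mixed_perm mf);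
    rewrite perm_sym -cat_rcons -cats1 -catA perm_catCA.
rewrite mid in Mi; have [l [ls Ml lr]] := IH _ Mi.
by exists (i :: l); rewrite /= ls ir mid.
Qed.

End MixedForms.

Lemma sum_nat_block (V : nmodType) (F : nat -> V) a b :
  \sum_(0 <= t < a * b) F t =
    \sum_(0 <= i < a) \sum_(0 <= j < b) F (i * b + j)%N.
Proof.
elim: a => [|a IH]; first by rewrite mul0n !big_geq.
rewrite big_nat_recr //= -IH mulSn addnC
  (@big_cat_nat _ _ _ (a * b)) //= ?leq_addr //.
congr (_ + _); rewrite -{1}[(a * b)%N]add0n big_addn addKn.
by apply: eq_bigr => j _; rewrite addnC.
Qed.

(** Among [d] positions spread over [n] levels, an average over positions of a
    nonincreasing function is at least its average over levels: cut the
    interval [[0, n * d]] into [n] blocks of length [d], or into [d] blocks of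
    length [n]. *)
Lemma level_average (R : realFieldType) (d n : nat) (y : nat -> R) :
  (0 < d)%N ->
  (forall j k, (j <= k < n)%N -> y k <= y j) ->
  d%:R * \sum_(0 <= k < n) y k <= n%:R * \sum_(0 <= i < d) y (level d n i).
Proof.
move=> d0 ymono.
have -> : d%:R * \sum_(0 <= k < n) y k = \sum_(0 <= t < n * d) y (t %/ d)%N.
  rewrite sum_nat_block mulr_sumr; apply: eq_bigr => k _.
  rewrite (@eq_big_nat _ _ _ _ _ _ (fun=> y k)) => [|j /andP[_ jd]].
    by rewrite sumr_const_nat subn0 mulr_natl.
  by rewrite divnMDl // divn_small // addn0.
rewrite mulnC sum_nat_block mulr_sumr; apply: ler_sum_nat => i /andP[_ id].
have -> : n%:R * y (level d n i) = \sum_(0 <= j < n) y (level d n i).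
  by rewrite sumr_const_nat subn0 mulr_natl.
apply: ler_sum_nat => j /andP[_ jn]; apply: ymono; rewrite /level.
rewrite leq_div2r ?leq_addr //= ltn_divLR //.
have : (i.+1 * n <= d * n)%N by rewrite leq_mul2r id orbT.
by rewrite mulSn; lia.
Qed.

(** * Garding polynomials *)

Section Garding.
Variables (R : realType) (W : vectType R) (K : set W).
Implicit Types (F G : pol W) (P Q w : W) (u : seq W).

Lemma pdeg_gt0_pderiv F P : pderiv P F != 0 -> (0 < pdeg F)%N.
Proof.
apply: contraNT; rewrite -eqn0Ngt => /eqP F0.
by rewrite pderiv_const //; apply: deg_lt_pdeg; rewrite F0.
Qed.

Lemma garding_pderiv F P : garding K F -> K P -> pderiv P F != 0 ->
  garding K (pderiv P F) /\ ray_component K F `<=` ray_component K (pderiv P F).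
Proof. by case=> _ _ g s KP PF; split; [apply: g|apply: s] => //;
  apply: pdeg_gt0_pderiv PF. Qed.

Lemma ray_component_pos F w : ray_component K F w -> 0 < peval F w.
Proof. by case=> U [[x _ ->] _] /connected_component_sub. Qed.

Lemma ray_componentD F w P : ray_component K F w -> K P ->
  ray_component K F (w + P).
Proof. by case=> U [Ux Uray] Uw KP; exists U => //; apply: Uray. Qed.

Lemma garding_ray_component F : garding K F -> exists w, ray_component K F w.
Proof.
case=> _ [U UF] _ _; case: (UF) => [[x Fx UE] _].
by exists x; exists U => //; rewrite UE; exact: connected_component_refl.
Qed.

Lemma line_connected w P :
  @connected (vtop W) [set w + t *: P | t in [set: R]].
Proof.
apply: (@connected_continuous_connected R (vtop W) setT (fun t => w + t *: P)).
  by apply/connected_intervalP => x y _ _ z _.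
apply: continuous_subspaceT; apply: continuous_comp_initial.
rewrite (_ : _ \o _ = fun t : R => passmx.rVof (vbasis {:W}) w +
    t *: passmx.rVof (vbasis {:W}) P); last first.
  apply/funext => t /=; apply/rowP => i.
  by rewrite !mxE (linearD (coord _ i)) (linearZ_LR (coord _ i)).
move=> t; apply: cvgD; first exact: cvg_cst.
exact: scalel_continuous.
Qed.

(** The component contains every connected part of [{F > 0}] that it meets, and
    lines are connected. *)
Lemma ray_component_line F w P : ray_component K F w ->
  (forall t, 0 < peval F (w + t *: P)) ->
  forall t, ray_component K F (w + t *: P).
Proof.
move=> [U [[x Fx UE] Uray] Uw] FP t; exists U; first by split => //; exists x.
rewrite UE (@same_connected_component (vtop W) (ppos F) x w);
  last by rewrite -UE.
apply: (@connected_component_max (vtop W) _ [set w + t *: P | t in [set: R]]).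
- by exists 0 => //; rewrite scale0r addr0.
- by move=> _ [s _ <-]; exact: FP.
- exact: line_connected.
- by exists t.
Qed.

Lemma pderivs_garding u F w : garding K F -> all_in K u ->
  ray_component K F w -> pderivs u F != 0 ->
  garding K (pderivs u F) /\ ray_component K (pderivs u F) w.
Proof.
move=> gF Ku Fw; elim: u Ku => [|P u IH] Ku; first by move=> _; split.
rewrite -[pderivs (P :: u) F]/(pderiv P (pderivs u F)) => PuF.
have [gu uw] : garding K (pderivs u F) /\ ray_component K (pderivs u F) w.
  apply: IH => [x xu|]; first by apply: Ku; rewrite inE xu orbT.
  by apply: contraNneq PuF => ->; rewrite linear0.
have KP : K P by apply: Ku; rewrite inE eqxx.
by have [g /(_ _ uw)] := garding_pderiv gu KP PuF.
Qed.

(** Derivatives along the cone are Garding on a larger component, or vanish. *)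
Lemma pderivs_ge0 u F w : garding K F -> all_in K u ->
  ray_component K F w -> 0 <= peval (pderivs u F) w.
Proof.
move=> gF Ku Fw; have [->|uF] := eqVneq (pderivs u F) 0.
  by rewrite /peval meval0.
by have [_ /ray_component_pos/ltW] := pderivs_garding gF Ku Fw uF.
Qed.

Lemma size_line w P F k : deg_lt k F -> (size (line w P F) <= k)%N.
Proof.
move=> Fk; apply/leq_sizeP => j kj.
have /eqP : (line w P F)`_j *+ j`! = 0.
  rewrite line_coef -pderivs_nseq (_ : pderivs _ _ = 0) /peval ?meval0 //.
  apply: deg_lt0; apply: deg_lt_pderivs; rewrite size_nseq addn0 => m jm.
  by apply: Fk; exact: leq_trans jm.
by rewrite mulrn_eq0 gtn_eqF ?fact_gt0 //= => /eqP.
Qed.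

Lemma taylor1 F w P t : deg_lt 2 F ->
  peval F (w + t *: P) = peval F w + t * peval (pderiv P F) 0.
Proof.
move=> F2; rewrite -horner_line (horner_coef_wide _ (size_line w P F2)).
rewrite !big_ord_recl big_ord0 addr0 expr0 expr1 mulr1.
have := line_coef w P F 0; have := line_coef w P F 1.
rewrite !mulr1n /= => -> ->; rewrite mulrC; congr (_ + _ * _).
by rewrite !(peval_const _ (deg_lt_pderiv _ F2)).
Qed.

Lemma taylor2 F w P t : deg_lt 3 F -> peval F (w + t *: P) =
  peval F w + t * peval (pderiv P F) w
  + t ^+ 2 * (peval (pderiv P (pderiv P F)) 0 / 2).
Proof.
move=> F3; rewrite -horner_line (horner_coef_wide _ (size_line w P F3)).
rewrite !big_ord_recl big_ord0 addr0 expr0 expr1 mulr1 addrA.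
have := line_coef w P F 0; have := line_coef w P F 1; have := line_coef w P F 2.
rewrite !mulr1n /= => H2 -> ->; rewrite [in t * _]mulrC mulrC;
  congr (_ + _ + _).
rewrite !(peval_const _ (deg_lt_pderiv _ (deg_lt_pderiv _ F3))) in H2 *.
rewrite -H2 (_ : _ *+ 2`! = (line w P F)`_2 * 2) ?mulr_natr //.
by rewrite -[X in _ = _ * (X / _)]mulr_natr mulfK ?pnatr_eq0 // mulrC.
Qed.

Lemma quadratic_le0 (a b c : R) :
  (forall r, 0 <= r -> a * r ^+ 2 + b * r + c <= 0) -> a <= 0.
Proof.
move=> H; rewrite leNgt; apply/negP => a0.
pose r := 1 + (`|b| + `|c|) / a.
have r1 : 1 <= r by rewrite lerDl divr_ge0 ?addr_ge0 // ltW.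
(* At this [r] the quadratic term beats the two others. *)
have /H : 0 <= r by lra.
have ar : a * r = a + `|b| + `|c|.
  by rewrite /r mulrDr mulr1 mulrCA divff ?mulr1 ?addrA // gt_eqF.
rewrite expr2 mulrA ar; have := ler_norm (- b); have := ler_norm (- c).
by rewrite !normrN; move: (normr_ge0 b) (normr_ge0 c); nra.
Qed.

End Garding.

Section GardingMixed.
Variables (R : realType) (W : vectType R) (K : set W) (e : W) (G : pol W).
Implicit Types (F : pol W) (P Q w : W) (u : seq W).

Definition mixed u := peval (pderivs u G) 0.

Hypothesis KD : forall P Q, K P -> K Q -> K (P + Q).
Hypothesis KZ : forall a P, 0 <= a -> K P -> K (a *: P).
Hypothesis Ke : K e.
Hypothesis gG : garding K G.

Let d := pdeg G.

Lemma deg_lt_pderivs_pdeg u k : (size u + k = d)%N -> deg_lt k.+1 (pderivs u G).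
Proof. by move=> ud; apply: deg_lt_pderivs; rewrite addnS ud;
  exact: deg_lt_pdeg. Qed.

Lemma mixed_const u w : size u = d -> peval (pderivs u G) w = mixed u.
Proof.
by move=> ud;
  rewrite /mixed !(peval_const _ (@deg_lt_pderivs_pdeg u 0 _)) ?addn0.
Qed.

(** If the restriction of [F] to a line through a point [y] of the component
    had no root, that line would stay in the component, although the affine
    function [pderiv P F], positive on the component, vanishes on it. *)
Lemma garding_discriminant F y P : garding K F -> deg_lt 3 F -> K P ->
  ray_component K F y -> 0 < peval (pderiv P (pderiv P F)) 0 ->
  2 * peval (pderiv P (pderiv P F)) 0 * peval F y <= peval (pderiv P F) y ^+ 2.
Proof.
move=> gF F3 KP Fy; set pp := peval _ 0 => pp0; rewrite leNgt;
  apply/negP => disc.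
have pos t : 0 < peval F (y + t *: P).
  rewrite taylor2 // -/pp -(pmulr_rgt0 _ pp0).
  move: (peval F y) (peval (pderiv P F) y) disc => a b disc.
  have := sqr_ge0 (pp * t + b); nra.
have PF : pderiv P F != 0.
  apply/eqP => PF0; move: pp0; rewrite /pp PF0 linear0 /peval meval0.
  by rewrite ltxx.
(* The line reaches the zero of the affine function [pderiv P F]. *)
have [_ sub] := garding_pderiv gF KP PF.
have := sub _ (ray_component_line Fy pos (- peval (pderiv P F) y / pp)).
move=> /ray_component_pos; rewrite taylor1; last exact: deg_lt_pderiv.
by rewrite -/pp mulfVK ?gt_eqF // subrr ltxx.
Qed.

(** The discriminant inequality at [x + r Q] is a quadratic inequality in [r];
    its leading coefficient is the claim. *)
Lemma garding_AF P Q u : (size u).+2 = d -> K P -> K Q -> all_in K u ->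
  mixed [:: P, P & u] * mixed [:: Q, Q & u] <= mixed [:: P, Q & u] ^+ 2.
Proof.
move=> ud KP KQ Ku; rewrite /mixed /= -/(pderivs u G).
set F := pderivs u G.
have F3 : deg_lt 3 F by apply: deg_lt_pderivs_pdeg; rewrite addn2.
have [x Gx] := garding_ray_component gG.
have [F0|FN0] := eqVneq F 0.
  by rewrite F0 !linear0 /peval meval0 mul0r sqr_ge0.
have [gF Fx] := pderivs_garding gG Ku Gx FN0.
have : 0 <= peval (pderiv P (pderiv P F)) 0.
  have -> : peval (pderiv P (pderiv P F)) 0 = peval (pderivs [:: P, P & u] G) x.
    by rewrite (@mixed_const [:: P, P & u] x).
  apply: (pderivs_ge0 gG _ Gx).
  by do 2!apply: all_in_cons => //.
rewrite le_eqVlt => /orP[/eqP <-|pp0]; first by rewrite mul0r sqr_ge0.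
set pp := peval (pderiv P (pderiv P F)) 0 in pp0 *.
rewrite -subr_le0.
have main r : 0 <= r -> 2 * pp * peval F (x + r *: Q)
    <= peval (pderiv P F) (x + r *: Q) ^+ 2.
  by move=> r0; apply: garding_discriminant => //; apply/ray_componentD/KZ.
apply: (@quadratic_le0 _ _ (2 * pp * peval (pderiv Q F) x
    - 2 * peval (pderiv P F) x * peval (pderiv P (pderiv Q F)) 0)
  (2 * pp * peval F x - peval (pderiv P F) x ^+ 2)) => r /main.
rewrite taylor2 // taylor1; last exact: deg_lt_pderiv.
rewrite (pderiv_comm Q P) -subr_le0; congr (_ <= _); by field.
Qed.

Lemma garding_mixed_form : mixed_form K e d mixed.
Proof.
split=> //.
- by move=> u v uv; rewrite /mixed (perm_pderivs _ uv).
- by move=> P Q u; rewrite /mixed /= pderivDl /peval mevalD.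
- by move=> a P u; rewrite /mixed /= pderivZl /peval mevalZ.
- move=> u ud Ku; have [x Gx] := garding_ray_component gG.
  by rewrite -(mixed_const x ud); exact: pderivs_ge0 Gx.
- exact: garding_AF.
Qed.

Hypothesis Kunit : forall P, exists2 c, 0 <= c & K (c *: e - P).

(** Every element of the cone is dominated by a multiple of the unit. *)
Lemma cone_word_zero u : mixed (nseq d e) <= 0 -> size u = d -> all_in K u ->
  mixed u = 0.
Proof.
move=> Me ud Ku; have mf := garding_mixed_form.
apply/eqP; rewrite eq_le (mixed_ge0 mf) // andbT.
pose c P := sval (cid2 (Kunit P)).
have [c0 cK] : (forall P, 0 <= c P) /\ (forall P, K (c P *: e - P)).
  by split=> P; rewrite /c; case: cid2.
pose x i := c (nth 0 u i); pose v := [seq x i *: e | i <- iota 0 d].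
have -> : 0 = (\prod_(i <- iota 0 d) x i) * 0 by rewrite mulr0.
apply: (@le_trans _ _ (mixed (v ++ [::]))); last first.
  have constE (s : seq nat) : [seq e | _ <- s] =
    nseq (size s) e by elim: s => //= i s ->.
  rewrite (mixed_scale mf x (fun=> e)) cats0 constE size_iota.
  by apply: ler_wpM2l => //; apply: prodr_ge0 => i _; exact: c0.
rewrite -[u]cats0; apply: (mixed_mono mf) => //.
- by rewrite size_map size_iota.
- by rewrite addn0.
- by move=> _ /mapP[i _ ->]; apply: KZ => //; exact: c0.
- move=> i; rewrite ud => id; rewrite (nth_map 0%N) ?size_iota // nth_iota //.
  exact: cK.
Qed.

(** Otherwise the mixed form vanishes on the cone, hence everywhere by
    multilinearity; on the vectors of a basis its values are, up to positive
    factors, the coefficients of top degree. *)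
Lemma mixed_unit_gt0 : 0 < mixed (nseq d e).
Proof.
have mf := garding_mixed_form.
rewrite ltNge; apply/negP => Me.
(* Each letter [X] is a difference of two elements of the cone. *)
have word u v : all_in K u -> (size v + size u)%N = d -> mixed (v ++ u) = 0.
  elim: v u => [|X v IH] u Ku /= ud; first exact: cone_word_zero.
  have [c c0 KX] := Kunit (- X); rewrite opprK addrC in KX.
  rewrite -[X](addrK (c *: e)) (mixedD mf) -scaleNr (mixedZ mf).
  have mid P : mixed (P :: v ++ u) = mixed (v ++ P :: u).
    by apply: (mixed_perm mf);
      rewrite perm_sym -cat_rcons -cats1 -catA perm_catCA.
  rewrite !mid !IH /= ?mulr0 ?addr0 ?addnS -?ud //; exact: all_in_cons.
case: (gG) => G0 _ _ _; have [m md] := pdeg_coef G0 erefl.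
have [l lm] := word_mnmP m; have ld : size l = d by rewrite -mdeg_word_mnm lm.
have [c c0] := mcoeff_mderivs G l mnm0.
have -> : mnm_add mnm0 (word_mnm l) = m.
  by apply/mnmP => j; rewrite mnmDE mnm0E lm.
pose b := [seq (vbasis {:W})`_i | i : 'I_(\dim {:W}) <- l].
have -> : foldr (@mderiv _ R) G l = pderivs b G.
  by rewrite /b; elim: (l) => //= i s ->; rewrite pderiv_basis.
have b0 : mixed b = 0 by rewrite -[b]cats0 word ?size_map ?addn0.
rewrite -(peval_const 0 (@deg_lt_pderivs_pdeg b 0 _)) ?addn0 ?size_map //.
rewrite -/(mixed b) b0 => /esym/eqP; rewrite mulrn_eq0 gtn_eqF //=.
by move=> ->.
Qed.

End GardingMixed.

(** * The homogeneous top part *)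

Section TopPart.
Variables (R : realType) (W : vectType R) (K : set W) (e : W) (G : pol W).
Implicit Types (F : pol W) (P Q w : W) (u : seq W).

Hypothesis KD : forall P Q, K P -> K Q -> K (P + Q).
Hypothesis KZ : forall a P, 0 <= a -> K P -> K (a *: P).
Hypothesis Ke : K e.
Hypothesis gG : garding K G.
Hypothesis Kunit : forall P, exists2 c, 0 <= c & K (c *: e - P).

Let d := pdeg G.
Let H := ptop G.
Let mf : mixed_form K e d (mixed G) := garding_mixed_form KD KZ Ke gG.

Lemma peval_ptop P : peval H P *+ d`! = mixed G (nseq d P).
Proof.
rewrite (peval_homog _ (@homog_ptop _ _ G)) -pderivs_nseq pderivs_ptop //.
by rewrite size_nseq.
Qed.

Lemma coef_line_ptop P j : (j <= d)%N ->
  (line e P H)`_j *+ j`! *+ (d - j)`! = mixed G (fill e d (nseq j P)).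
Proof.
move=> jd; rewrite line_coef (@peval_homog _ _ (d - j)); last first.
  rewrite -pderivs_nseq; apply: homog_pderivs.
  by rewrite size_nseq subnKC //; exact: homog_ptop.
rewrite -!pderivs_nseq -pderivs_cat pderivs_ptop; last first.
  by rewrite size_cat !size_nseq subnK.
rewrite /mixed /fill size_nseq; congr (peval _ _); apply: perm_pderivs.
by rewrite perm_catC.
Qed.

(** The coefficients of [H (e + t P)] are positive multiples of the mixed
    values of powers of [P], and these decrease with the exponent because
    [P <= e]. *)
Lemma line_ptop_degreeP P j : K P -> K (e - P) -> (j <= d)%N ->
  (j <= (size (line e P H)).-1)%N <-> 0 < mixed G (fill e d (nseq j P)).
Proof.
move=> KP KeP jd; have Me := mixed_unit_gt0 KD KZ Ke gG Kunit.
have coef0 i : (i <= d)%N -> 0 < mixed G (fill e d (nseq i P)) ->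
    (i < size (line e P H))%N.
  move=> id Mi; rewrite ltnNge; apply/negP => si.
  by move: Mi; rewrite -coef_line_ptop // nth_default // !mul0rn ltxx.
split=> [js|Mj]; last first.
  by rewrite -ltnS (leq_trans (coef0 _ jd Mj)) // leqSpred.
have s0 : (0 < size (line e P H))%N by apply: coef0; rewrite // /fill subn0.
have sd : ((size (line e P H)).-1 <= d)%N.
  by rewrite -ltnS prednK //; apply: size_line; apply/homog_deg_lt/homog_ptop.
set k := (size _).-1 in js sd.
apply: (@lt_le_trans _ _ (mixed G (fill e d (nseq k P)))).
  have Kfill : all_in K (fill e d (nseq k P)).
    by apply: all_in_cat; exact: all_in_nseq.
  have sfill : size (fill e d (nseq k P)) = d.
    by rewrite size_cat !size_nseq subnKC.
  rewrite lt_neqAle (mixed_ge0 mf) // andbT -coef_line_ptop // eq_sym.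
  rewrite !mulrn_eq0 !gtn_eqF ?fact_gt0 //=.
  by rewrite -/(lead_coef _) lead_coef_eq0 -size_poly_gt0.
rewrite /fill !size_nseq.
have -> : nseq k P ++ nseq (d - k) e =
  nseq j P ++ nseq (k - j) P ++ nseq (d - k) e.
  by rewrite catA -nseqD subnKC.
have -> : nseq (d - j) e = nseq (k - j) e ++ nseq (d - k) e.
  by rewrite -nseqD; congr (nseq _ _); lia.
have mid x : mixed G (nseq j P ++ nseq (k - j) x ++ nseq (d - k) e) =
    mixed G (nseq (k - j) x ++ nseq j P ++ nseq (d - k) e).
  by apply: (mixed_perm mf); rewrite perm_catCA.
rewrite !mid; apply: (mixed_mono mf).
- by rewrite !size_nseq.
- by rewrite !size_cat !size_nseq; lia.
- exact: all_in_nseq.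
- exact: all_in_nseq.
- by apply: all_in_cat; exact: all_in_nseq.
- by rewrite size_nseq => i ik; rewrite !nth_nseq ik.
Qed.

Lemma coef_line_top A P : (line A P G)`_d = peval H P.
Proof.
apply: (@mulIf _ (d`!)%:R); first by rewrite pnatr_eq0 -lt0n fact_gt0.
rewrite !mulr_natr peval_ptop line_coef -pderivs_nseq.
by rewrite (mixed_const A) // size_nseq.
Qed.

(** All coefficients of [t |-> G (A + t P)] but the constant one are
    nonnegative when [A] lies in the components of all derivatives, and the
    leading one is [H P]. *)
Lemma ptop_le_increment A P : (0 < d)%N -> ray_component1 K G A -> K P ->
  peval H P <= peval G (A + P) - peval G A.
Proof.
move=> d0 CA KP; have sz := size_line A P (deg_lt_pdeg (ltnSn (pdeg G))).
have -> : peval G (A + P) - peval G A = \sum_(i < d) (line A P G)`_i.+1.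
  rewrite -[X in A + X]scale1r -horner_line (horner_coef_wide _ sz).
  rewrite big_ord_recl expr0 mulr1.
  have := line_coef A P G 0; rewrite mulr1n /= => ->;
    rewrite addrAC subrr add0r.
  by apply: eq_bigr => i _; rewrite expr1n mulr1.
have coef_ge0 i : 0 <= (line A P G)`_i.+1.
  rewrite -(@pmulrn_lge0 _ _
    (i.+1)`!) ?fact_gt0 // line_coef iterSr -pderivs_nseq.
  have [->|PG] := eqVneq (pderiv P G) 0.
    by rewrite pderivs0 /peval meval0.
  have [gP _] := garding_pderiv gG KP PG.
  by apply: (pderivs_ge0 gP); [exact: all_in_nseq|exact: CA].
rewrite -(coef_line_top A P) -(prednK d0) big_ord_recr /= lerDr.
by apply: sumr_ge0 => i _; exact: coef_ge0.
Qed.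

End TopPart.

(** * Growth and interior points *)

Section Growth.
Variable R : realType.
Implicit Types (p : {poly R}).

Lemma horner_le_growth p r : (size p <= r.+1)%N ->
  exists2 C : R, 0 < C & forall t, 1 <= t -> p.[t] <= C * t ^+ r.
Proof.
move=> pr; exists (1 + \sum_(i < r.+1) `|p`_i|).
  by rewrite ltr_pwDl // sumr_ge0.
move=> t t1; rewrite (horner_coef_wide _ pr) mulrDl mulr_suml mul1r.
apply: ler_wpDl; first by rewrite exprn_ge0 // (le_trans _ t1).
apply: ler_sum => i _; apply: (@le_trans _ _ (`|p`_i| * t ^+ i)).
  by rewrite ler_wpM2r ?ler_norm // exprn_ge0 // (le_trans _ t1).
by rewrite ler_wpM2l // ler_weXn2l // -ltnS.
Qed.

Lemma coef_ge0_growth p k : (size p <= k.+1)%N ->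
  (forall t, 1 <= t -> 0 <= p.[t]) -> 0 <= p`_k.
Proof.
move=> pk p0; rewrite leNgt; apply/negP => pk0.
have sp : size p = k.+1.
  apply/eqP; rewrite eqn_leq pk ltnNge;
    apply/negP => /leq_sizeP/(_ _ (leqnn _)) E.
  by rewrite E ltxx in pk0.
have lp : 0 < lead_coef (- p) by rewrite lead_coefN lead_coefE sp oppr_gt0.
have [n pn] := polyrcf.poly_pinfty_gt_lc lp.
have := p0 (Num.max 1 n); rewrite le_max lexx => /(_ isT).
have := pn (Num.max 1 n); rewrite le_max lexx orbT => /(_ isT).
by rewrite hornerN => /(lt_le_trans lp);
  rewrite oppr_gt0 => /lt_le_trans/[apply]; rewrite ltxx.
Qed.

End Growth.

Section Interior.
Variables (R : realType) (W : vectType R) (K : set W) (e : W) (G : pol W).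
Implicit Types (P Q w : W).

Hypothesis KD : forall P Q, K P -> K Q -> K (P + Q).
Hypothesis KZ : forall a P, 0 <= a -> K P -> K (a *: P).
Hypothesis Ke : K e.
Hypothesis Kunit : forall P, exists2 c, 0 <= c & K (c *: e - P).

Lemma cone_sum (I : Type) (r : seq I) (F : I -> W) :
  (forall i, K (F i)) -> K (\sum_(i <- r) F i).
Proof.
move=> KF; elim/big_rec: _ => [|i x _]; last exact: KD.
by rewrite -(scale0r e); apply: KZ.
Qed.

(** A small [Z] is a combination with small coefficients of basis vectors, each
    of which is dominated by a multiple of [e], as is its opposite. *)
Lemma cone_unit_nbhs : exists2 eps : R, 0 < eps &
  forall Z, (forall i, `|crd Z i| < eps) -> K (e + Z).
Proof.
pose b (i : 'I_(\dim {:W})) := (vbasis {:W})`_i.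
have cP i : exists2 c : R, 0 <= c & K (c *: e - b i) /\ K (c *: e + b i).
  have [c1 c10 K1] := Kunit (b i); have [c2 c20] := Kunit (- b i).
  rewrite opprK => K2; exists (c1 + c2); rewrite ?addr_ge0 //; split.
    by rewrite addrC scalerDl addrA [- _ + _]addrC; apply/KD/KZ.
  by rewrite scalerDl -addrA; apply: KD => //; exact: KZ.
pose c i := sval (cid2 (cP i)).
have c0 i : 0 <= c i by rewrite /c; case: cid2.
have [cm cp] : (forall i, K (c i *: e - b i)) /\ (forall i, K (c i *: e + b i)).
  by split=> i; rewrite /c; case: cid2 => ? ? [].
have S0 : 0 < 1 + \sum_i c i by rewrite ltr_pwDl // sumr_ge0.
exists (1 + \sum_i c i)^-1; first by rewrite invr_gt0.
move=> Z Ze; rewrite [Z]crd_sum.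
have -> : e + \sum_i crd Z i *: b i =
    (1 - \sum_i `|crd Z i| * c i) *: e + \sum_i (`|crd Z i| *:
      (c i *: e) + crd Z i *: b i).
  rewrite big_split /= addrA; congr (_ + _).
  have -> : \sum_i `|crd Z i| *: (c i *: e) = (\sum_i `|crd Z i| * c i) *: e.
    by rewrite scaler_suml; apply: eq_bigr => i _; rewrite scalerA.
  by rewrite -scalerDl subrK scale1r.
apply: KD.
  apply: KZ => //; rewrite subr_ge0.
  apply: (@le_trans _ _ ((1 + \sum_i c i)^-1 * \sum_i c i)).
    by rewrite mulr_sumr; apply: ler_sum => i _; rewrite ler_wpM2r // ltW.
  by rewrite mulrC ler_pdivrMr // mul1r lerDr.
apply: cone_sum => i; have [z0|z0] := leP 0 (crd Z i).
  by rewrite ger0_norm // -scalerDr; exact: KZ.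
rewrite ltr0_norm // -[X in _ + X *: _]opprK
  [X in _ + X]scaleNr -scalerN -scalerDr.
by apply: KZ; rewrite ?oppr_ge0 // ltW.
Qed.

(** The component contains [w + K], which is a neighbourhood of [w + e]. *)
Lemma interior_ray_component1 : garding K G ->
  exists w, interior (ray_component1 K G) w.
Proof.
move=> gG; have [w Gw] := garding_ray_component gG.
exists (w + e); have [eps eps0 He] := cone_unit_nbhs.
pose f := passmx.rVof (vbasis {:W}).
pose B : set 'rV[R]_(\dim {:W}) :=
  [set v | forall i, `|f (w + e) 0 i - v 0 i| < eps].
have nB : nbhs (f (w + e)) B.
  by apply/nbhs_ballP; exists eps => // v [_ bv] i; exact: bv.
have nfB : nbhs (w + e : vtop W) (f @^-1` B).
  exact: (@initial_continuous _ _ (f : W -> _) (w + e) _ nB).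
apply: (@filterS _ _ (@nbhs_filter (vtop W)
  (w + e)) _ _ _ nfB) => y yB P KP PG; have [_ ] := garding_pderiv gG KP PG;
    apply.
have -> : y = w + (e + (y - (w + e))) by rewrite addrA [RHS]addrC subrK.
apply: ray_componentD Gw _; apply: He => i.
by have := yB i; rewrite distrC /f !mxE /crd linearB.
Qed.

End Interior.

(** * Spectral theory of Hermitian forms *)

Section Eigenvector.
Variables (C : numClosedFieldType) (V : vectType C).

(** An eigenvector of the matrix of [f] restricted to [U]. *)
Lemma eigenvector_exists (f : 'End(V)) (U : {vspace V}) : U != 0%VS ->
  {in U, forall u, f u \in U} ->
  exists u a, [/\ u \in U, u != 0 & f u = a *: u].
Proof.
move=> U0 fU; pose g : 'End(subvs_of U) := linfun (vsproj U \o f \o vsval).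
have gE w : vsval (g w) = f (vsval w).
  by rewrite lfunE /= vsprojK //; apply: fU; exact: subvsP.
pose e := vbasis {:subvs_of U}.
have eb : basis_of {:subvs_of U} e by exact: vbasisP.
have dU : (0 < \dim {:subvs_of U})%N by rewrite dimvf /dim /= lt0n dimv_eq0.
have [a /eigenvalueP[r ra r0]] :=
  spectral.eigenvalue_closed (passmx.mxof e e g) dU.
exists (vsval (passmx.vecof e r)), a; split; first exact: subvsP.
  by rewrite (_ : 0 =
    vsval (0 : subvs_of U)) // (inj_eq subvs_inj) passmx.vecof_eq0.
rewrite -gE (passmx.hom_vecof e eb) ra.
have -> : passmx.vecof e (a *: r) = a *: passmx.vecof e r; last by [].
rewrite /passmx.vecof scaler_sumr; apply: eq_bigr => i _.
by rewrite mxE scalerA.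
Qed.

End Eigenvector.

Section Unitary.
Variables (R : realType) (V : vectType R[i]) (rho : {dot V for conjC}).
Local Open Scope complex_scope.
Local Notation n := (\dim {:V}).
Implicit Types (f P Q : herm rho) (U : {vspace V}).

Lemma eigenvalue_herm f u a : u != 0 -> f u = a *: u -> a = (complex.Re a)%:C.
Proof.
move=> u0 fu; have := hermP f u u; rewrite fu linearZl_LR linearZr_LR /=.
move=> /mulIf; rewrite dnorm_eq0 u0 => /(_ isT) E.
by apply/esym/RRe_real; rewrite CrealE; apply/eqP/esym.
Qed.

(** Induction on the dimension: the orthogonal in [U] of an eigenvector is
    again invariant. *)
Lemma orthonormal_eigenbasis f U : {in U, forall u, f u \in U} ->
  exists s, [/\ size s = \dim U, orthonormal rho s, {subset s <= U} &
    {in s, forall v, exists x : R, f v = x%:C *: v}].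
Proof.
move: {2}(\dim U) (erefl (\dim U)) => k; elim: k U => [|k IH] U dU fU.
  by exists [::]; rewrite dU.
have U0 : U != 0%VS by rewrite -dimv_eq0 dU.
have [u [a [uU u0 fu]]] := eigenvector_exists U0 fU.
have aE := eigenvalue_herm u0 fu.
pose U' := (U :&: orthov rho <[u]>)%VS.
have dU' : \dim U' = k.
  rewrite -eq_dim_orthov1 ?dU //; apply/mem_orthovPn; exists u => //.
  by rewrite dnorm_eq0.
have fU' : {in U', forall w, f w \in U'}.
  move=> w /memv_capP[wU]; rewrite mem_orthov1 => /eqP wu.
  apply/memv_capP; split; first exact: fU.
  by rewrite mem_orthov1; apply/eqP;
    rewrite [LHS](hermP f w u) fu linearZr_LR /= wu mulr0.
have [s [ss so sU' sf]] := IH U' dU' fU'.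
pose v := (sqrtC (rho u u))^-1 *: u.
exists (v :: s); split.
- by rewrite /= ss dU' dU.
- rewrite -cat1s orthonormal_cat so /=; apply/andP; split.
    apply/orthonormalP; split=> // x y; rewrite !inE => /eqP-> /eqP->.
    rewrite eqxx /v dnormZ normrV ?unitfE ?sqrtC_eq0 ?dnorm_eq0 //.
    rewrite exprVn ger0_norm ?sqrt_dnorm_ge0 // sqrtCK mulVf ?dnorm_eq0 //.
  apply/orthoPl => y /sU'/memv_capP[_].
  rewrite mem_orthov1 => /eqP yu; rewrite /v linearZl_LR /=.
  by rewrite (eqP (_ : rho u y == 0)) ?mulr0 // herm_eq0C yu.
- move=> x; rewrite inE => /orP[/eqP->|/sU'/memv_capP[]//].
  by rewrite memvZ.
- move=> x; rewrite inE => /orP[/eqP->|/sf//]; exists (complex.Re a).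
  by rewrite /v linearZ /= fu -aE !scalerA mulrC.
Qed.

Lemma herm_sumE (I : Type) (r : seq I) (F : I -> herm rho) u :
  (\sum_(i <- r) F i : herm rho) u = \sum_(i <- r) F i u.
Proof.
elim: r => [|i r IH]; first by rewrite !big_nil /= lfunE.
by rewrite !big_cons /= add_lfunE -IH.
Qed.

Lemma herm_scaleEu (a : R) f u : (a *: f) u = a%:C *: f u.
Proof. by rewrite /= scale_lfunE. Qed.

Lemma rank1E v u : rank1 rho v u = rho u v *: v.
Proof. by rewrite /= lfunE. Qed.

Section Basis.
Variable v : n.-tuple V.
Hypothesis vu : unitary_basis rho v.

Let vb : basis_of {:V} v. Proof. by case/andP: vu. Qed.

Lemma unitaryE i j : rho (tnth v i) (tnth v j) = (i == j)%:R.
Proof.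
case/andP: vu => _ /orthonormalP[uq H]; rewrite H ?mem_tnth //.
by rewrite !(tnth_nth 0) nth_uniq ?size_tuple.
Qed.

Lemma unitary_expand u : u = \sum_i rho u (tnth v i) *: tnth v i.
Proof.
rewrite {1}(coord_basis vb (memvf u)); apply: eq_bigr => i _.
rewrite -tnth_nth; congr (_ *: _).
rewrite [in RHS](coord_basis vb (memvf u)) linear_sumlz (bigD1 i) //=.
rewrite linearZl_LR /= -tnth_nth unitaryE eqxx mulr1 big1
  ?addr0 // => j /negPf ji.
by rewrite linearZl_LR /= -tnth_nth unitaryE ji mulr0.
Qed.

Definition eigsum (x : 'I_n -> R) : herm rho :=
  \sum_i x i *: rank1 rho (tnth v i).

Lemma eigsumE x u : eigsum x u =
  \sum_i ((x i)%:C * rho u (tnth v i)) *: tnth v i.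
Proof.
rewrite /eigsum herm_sumE; apply: eq_bigr => i _.
by rewrite herm_scaleEu rank1E scalerA.
Qed.

Lemma eigsum_tnth x i : eigsum x (tnth v i) = (x i)%:C *: tnth v i.
Proof.
rewrite eigsumE (bigD1 i) //= unitaryE eqxx mulr1 big1 ?addr0 // => j /negPf ji.
by rewrite unitaryE eq_sym ji mulr0 scale0r.
Qed.

Lemma eigsum_eq f x : (forall i, f (tnth v i) = (x i)%:C *: tnth v i) ->
  f = eigsum x.
Proof.
move=> fx; apply/val_inj/lfunP => u /=.
rewrite [u]unitary_expand !linear_sum; apply: eq_bigr => i _.
by rewrite !linearZ /= fx eigsum_tnth.
Qed.

Lemma eigsum1 : herm1 rho = eigsum (fun=> 1).
Proof. by apply: eigsum_eq => i; rewrite /= id_lfunE scale1r. Qed.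

Lemma eigsumB x y : eigsum x - eigsum y = eigsum (fun i => x i - y i).
Proof. by rewrite /eigsum -sumrB; apply: eq_bigr => i _; rewrite scalerBl. Qed.

Lemma eigsumZ a x : a *: eigsum x = eigsum (fun i => a * x i).
Proof. by rewrite /eigsum scaler_sumr; apply: eq_bigr => i _;
  rewrite scalerA. Qed.

Lemma eigsum_form x u :
  rho (eigsum x u) u = (\sum_i x i * (complex.Re `|rho u (tnth v i)|) ^+ 2)%:C.
Proof.
rewrite eigsumE linear_sumlz rmorph_sum; apply: eq_bigr => i _.
rewrite linearZl_LR /= -mulrA (hermC rho (tnth v i)) expr0 mul1r -normCK.
have {1}<- : (complex.Re `|rho u (tnth v i)|)%:C = `|rho u (tnth v i)|.
  by rewrite RRe_real // normr_real.
by rewrite -rmorphXn -rmorphM.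
Qed.

Lemma psd_eigsum x : psd rho (eigsum x) <-> forall i, 0 <= x i.
Proof.
split=> [H i|x0 u].
  by have := H (tnth v i);
    rewrite eigsum_tnth linearZl_LR /= unitaryE eqxx mulr1 ler0c.
rewrite eigsum_form ler0c sumr_ge0 // => i _.
by rewrite mulr_ge0 // sqr_ge0.
Qed.

Lemma posdef_eigsum x : posdef rho (eigsum x) <-> forall i, 0 < x i.
Proof.
split=> [H i|x0 u u0].
  have v0 : tnth v i != 0 by rewrite -(dnorm_eq0 rho) unitaryE eqxx oner_eq0.
  by have := H _ v0;
    rewrite eigsum_tnth linearZl_LR /= unitaryE eqxx mulr1 ltcR.
rewrite eigsum_form ltcR lt_neqAle eq_sym sumr_ge0 ?andbT; last first.
  by move=> i _; rewrite mulr_ge0 ?sqr_ge0 // ltW.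
apply: contra u0 => /eqP s0; apply/eqP;
  rewrite [u]unitary_expand big1 // => i _.
have : x i * (complex.Re `|rho u (tnth v i)|) ^+ 2 = 0.
  by apply: (psumr_eq0P _ s0) => // j _; rewrite mulr_ge0 ?sqr_ge0 // ltW.
move/eqP; rewrite mulf_eq0 (gt_eqF (x0 i)) orFb sqrf_eq0 => /eqP r0.
have : `|rho u (tnth v i)| = 0 by rewrite -(RRe_real (normr_real _)) r0.
by move/normr0P/eqP => ->; rewrite scale0r.
Qed.

(** The matrix in the basis [v] is diagonal, and the change of basis does not
    affect the determinant. *)
Lemma det_eigsum x : det_rho (eigsum x) = \prod_i x i.
Proof.
have eb := vbasisP {:V}; set e := vbasis {:V} in eb.
have dec : eigsum x = (\1 \o (eigsum x \o \1))%VF :> 'End(V).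
  by rewrite comp_lfun1l comp_lfun1r.
rewrite /det_rho -/e dec (passmx.mxof_comp _ _ vb) (passmx.mxof_comp _ _ vb).
rewrite !det_mulmx.
have -> : passmx.mxof v v (eigsum x) = diag_mx (\row_i (x i)%:C).
  apply/matrixP => i j;
    rewrite !mxE /= passmx.vecof_delta -tnth_nth eigsum_tnth.
  rewrite linearZ /= [X in coord v j X](tnth_nth 0) coord_free
    ?(basis_free vb) //.
  by rewrite mulr_natr.
rewrite det_diag mulrAC -det_mulmx -(passmx.mxof_comp _ _ vb) comp_lfun1l.
rewrite passmx.mxof1 ?(basis_free eb) // det1 mul1r.
under eq_bigr do rewrite mxE.
by rewrite -rmorph_prod.
Qed.

End Basis.

Lemma herm_spectral f : exists v : n.-tuple V, unitary_basis rho v /\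
  exists x, f = eigsum v x.
Proof.
have [|s [ss so _ sf]] := @orthonormal_eigenbasis f fullv.
  by move=> u _; rewrite memvf.
have s_size : size s == n by rewrite ss.
have vu : unitary_basis rho (Tuple s_size).
  by rewrite /unitary_basis so andbT basisEfree
    (orthonormal_free so) subvf /= ss.
exists (Tuple s_size); split=> //.
have [x xE] := choice (fun i => sf _ (mem_tnth i (Tuple s_size))).
by exists x; exact: eigsum_eq.
Qed.

End Unitary.

(** * The cone of semipositive forms *)

Lemma daddv_pi_eq0 (F : fieldType) (V : vectType F) (U U' : {vspace V}) u :
  (U :&: U' = 0)%VS -> u \in U' -> daddv_pi U U' u = 0.
Proof.
move=> UU' uU';
  have uUU' : u \in (U + U')%VS by rewrite -[u]add0r memv_add ?mem0v.
have := daddv_pi_add UU' uUU'.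
by rewrite (daddv_pi_id _ uU') ?(capvC U') // => /(canRL (addrK _));
  rewrite subrr.
Qed.

Section PsdCone.
Variables (R : realType) (V : vectType R[i]) (rho : {dot V for conjC}).
Local Open Scope complex_scope.
Local Notation n := (\dim {:V}).
Implicit Types (P Q : herm rho) (U : {vspace V}) (S T : {set 'I_n}).

Lemma psdD P Q : psd rho P -> psd rho Q -> psd rho (P + Q).
Proof.
by move=> P0 Q0 v; rewrite /= add_lfunE linearDl addr_ge0;
  [|exact: P0|exact: Q0].
Qed.

Lemma psdZ (a : R) P : 0 <= a -> psd rho P -> psd rho (a *: P).
Proof.
move=> a0 P0 v; rewrite herm_scaleEu linearZl_LR /= mulr_ge0 ?ler0c //;
  exact: P0.
Qed.

Lemma psd1 : psd rho (herm1 rho).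
Proof. by move=> v; rewrite /= id_lfunE dnorm_ge0. Qed.

Lemma psd_unit P : exists2 c : R, 0 <= c & psd rho (c *: herm1 rho - P).
Proof.
have [v [vu [x ->]]] := herm_spectral P.
exists (\sum_i `|x i|); first by rewrite sumr_ge0.
rewrite (eigsum1 vu) eigsumZ eigsumB; apply/(psd_eigsum vu) => i.
rewrite mulr1 subr_ge0 (bigD1 i) //= (le_trans (ler_norm _)) // lerDl.
by rewrite sumr_ge0.
Qed.

Definition basis_span (v : n.-tuple V) S : {vspace V} :=
  <<[seq tnth v i | i <- index_enum 'I_n & i \in S]>>%VS.

Definition basis_proj (v : n.-tuple V) S :=
  eigsum rho v (fun i => (i \in S)%:R).

Lemma basis_projE v S : basis_proj v S = \sum_(i in S) rank1 rho (tnth v i).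
Proof.
rewrite /basis_proj /eigsum [RHS]big_mkcond; apply: eq_bigr => i _.
by case: (i \in S); rewrite ?scale1r ?scale0r.
Qed.

Lemma mem_basis_span v S i : i \in S -> tnth v i \in basis_span v S.
Proof.
move=> iS; apply: memv_span; apply: map_f.
by rewrite mem_filter iS mem_index_enum.
Qed.

Lemma dim_basis_span v S : unitary_basis rho v -> \dim (basis_span v S) = #|S|.
Proof.
move=> vu; case/andP: (vu) => /basis_free vf _.
have vi : injective (tnth v).
  move=> i j ij; have := unitaryE vu i j; rewrite ij (unitaryE vu) eqxx.
  by case: eqVneq => // _ /eqP; rewrite oner_eq0.
have /eqP -> : free [seq tnth v i | i <- index_enum 'I_n & i \in S].
  apply: (@orthonormal_free _ _ rho); case/andP: vu => _.
  apply: sub_orthonormal; first by move=> _ /mapP[i _ ->]; exact: mem_tnth.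
  by rewrite map_inj_uniq // filter_uniq // index_enum_uniq.
by rewrite -sum1_size big_map big_filter sum1_card.
Qed.

Lemma orth_proj_basis_span v S : unitary_basis rho v ->
  orth_proj rho (basis_span v S) = basis_proj v S.
Proof.
move=> vu; apply: (eigsum_eq vu) => i /=.
set U := basis_span v S; set U' := orthov rho U.
have UU' : (U :&: U' = 0)%VS by exact: orthov_cap.
have [iS|iS] := boolP (i \in S).
  by rewrite daddv_pi_id ?mem_basis_span // scale1r.
have iU' : tnth v i \in U'.
  apply/mem_orthovP => w; apply: span_orthogonal; last exact: memv_span1.
  apply/orthoPl => _ /mapP[j jS ->]; rewrite (unitaryE vu);
    case: eqVneq => // ij.
  by rewrite mem_filter -ij (negPf iS) in jS.
by rewrite scale0r; exact: daddv_pi_eq0.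
Qed.

(** An orthogonal projection has eigenvalues [0] and [1], and its range is
    spanned by the eigenvectors of eigenvalue [1]. *)
Lemma adapted_basis U : exists v S, unitary_basis rho v /\ U = basis_span v S.
Proof.
have [v [vu [x xE]]] := herm_spectral (orth_proj rho U).
have pU u : u \in U -> orth_proj rho U u = u.
  by move=> uU; rewrite /= daddv_pi_id ?orthov_cap.
have mU u : orth_proj rho U u \in U by exact: memv_pi.
have x01 i : x i = 0 \/ x i = 1.
  have /pU : orth_proj rho U (tnth v i) \in U by [].
  rewrite xE (eigsum_tnth vu) linearZ /= (eigsum_tnth vu) scalerA.
  have v0 : tnth v i != 0.
    by rewrite -(dnorm_eq0 rho) (unitaryE vu) eqxx oner_eq0.
  move/eqP; rewrite -subr_eq0 -scalerBl scaler_eq0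
    (negPf v0) orbF -rmorphM -rmorphB.
  move/eqP/complexI/eqP; rewrite -[X in _ - X]mulr1 -mulrBr mulf_eq0 subr_eq0.
  by move=> /orP[] /eqP; [left|right].
exists v, (finset (fun i => x i == 1)); split=> //; apply/eqP; rewrite eqEsubv.
apply/andP; split.
  apply/subvP => u uU; rewrite -(pU u uU) xE eigsumE; apply: memv_suml => i _.
  have [xi|xi] := x01 i; first by rewrite xi mul0r scale0r mem0v.
  by rewrite memvZ // mem_basis_span // inE xi.
apply/span_subvP => y /mapP[i iS ->]; move: iS.
rewrite mem_filter inE => /andP[/eqP xi _].
by have := mU (tnth v i); rewrite xE (eigsum_tnth vu) xi scale1r.
Qed.

Lemma psd_basis_proj v S : unitary_basis rho v -> psd rho (basis_proj v S).
Proof. by move=> vu; apply/(psd_eigsum vu) => i; rewrite ler0n. Qed.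

Lemma psd_basis_proj_sub v S T : unitary_basis rho v -> S \subset T ->
  psd rho (basis_proj v T - basis_proj v S).
Proof.
move=> vu /fintype.subsetP ST; rewrite eigsumB; apply/(psd_eigsum vu) => i.
by rewrite subr_ge0 ler_nat; have := ST i; case: (i \in S) => // ->.
Qed.

Lemma basis_projT v : unitary_basis rho v ->
  basis_proj v (finset.setTfor 'I_n) = herm1 rho.
Proof.
by move=> vu; rewrite (eigsum1 vu); apply: eq_bigr => i _; rewrite inE.
Qed.

Lemma psd_basis_proj_le1 v S : unitary_basis rho v ->
  psd rho (herm1 rho - basis_proj v S).
Proof. by move=> vu; rewrite -(basis_projT vu);
  apply: psd_basis_proj_sub => //; exact: finset.subsetT. Qed.

Definition qform P (u : V) : R := complex.Re (rho (P u) u).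

Lemma qformD P Q u : qform (P + Q) u = qform P u + qform Q u.
Proof.
by rewrite /qform /= add_lfunE linearDl /=; case: (rho _ _) => ? ?;
  case: (rho _ _).
Qed.

Lemma qformZ a P u : qform (a *: P) u = a * qform P u.
Proof.
rewrite /qform herm_scaleEu linearZl_LR /=; case: (rho _ _) => x y /=.
by rewrite mul0r subr0.
Qed.

Lemma psd_qform P : psd rho P <-> forall u, 0 <= qform P u.
Proof.
split=> P0 u; first by have := P0 u; rewrite /qform lecE => /andP[].
have zr : rho (P u) u \is Num.real.
  by rewrite CrealE {1}hermP; apply/eqP; rewrite [RHS](hermC rho) expr0 mul1r.
by rewrite -(RRe_real zr) ler0c; exact: P0.
Qed.

(** The trace, computed in the basis [w]; this form makes it visibly a
    continuous function of [P]. *)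
Definition htrace (w : n.-tuple V) P : R := \sum_a qform P (tnth w a).

(** Parseval's identity. *)
Lemma htrace_eigsum w v x : unitary_basis rho w -> unitary_basis rho v ->
  htrace w (eigsum rho v x) = \sum_i x i.
Proof.
move=> wu vu; rewrite /htrace.
under eq_bigr do rewrite /qform eigsum_form.
rewrite exchange_big /=; apply: eq_bigr => i _.
rewrite -mulr_sumr -[RHS]mulr1; congr (_ * _).
have := eigsum_form rho w (fun=> 1) (tnth v i).
rewrite -(eigsum1 wu) id_lfunE (unitaryE vu) eqxx => /(congr1 (@complex.Re R)).
rewrite [X in X = _]/= [X in _ = X]/= => ->.
apply: eq_bigr => a _; rewrite mul1r.
have -> : rho (tnth w a) (tnth v i) = (rho (tnth v i) (tnth w a))^*.
  by rewrite [LHS](hermC rho) expr0 mul1r.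
by case: (rho _ _) => y z; rewrite /= sqrrN.
Qed.

Lemma qformDr P u v :
  qform P (u + v) = qform P u + qform P v + 2 * complex.Re (rho (P u) v).
Proof.
rewrite /qform (linearD (herm_val P)) (linearDl rho) !(linearDr rho) /=.
have -> : rho (P v) u = (rho (P u) v)^*.
  by rewrite hermP [LHS](hermC rho) expr0 mul1r.
case: (rho (P u) u) => ? ?; case: (rho (P u) v) => ? ?;
  case: (rho (P v) v) => ? ? /=.
by ring.
Qed.

(** Positivity of [P] at [u + v] and [u - v]. *)
Lemma Re_form_le P u v : psd rho P -> psd rho (herm1 rho - P) ->
  `|complex.Re (rho (P u) v)| <= qform (herm1 rho) u + qform (herm1 rho) v.
Proof.
move=> /psd_qform P0 /psd_qform P1.
have le1 w : qform P w <= qform (herm1 rho) w.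
  by rewrite -subr_ge0 -mulN1r -qformZ -qformD scaleN1r.
have /le_trans -> // : `|complex.Re (rho (P u) v)| <= qform P u + qform P v.
  have := P0 (u + v); have := P0 (u - v);
    rewrite !qformDr (linearNr rho) (raddfN (@complex.Re R)) /=.
  have -> : qform P (- v) =
    qform P v by rewrite /qform (linearN (herm_val P)) (linearNl rho)
      (linearNr rho) opprK.
  have := P0 u; have := P0 v; rewrite ler_norml => *; apply/andP; split; lra.
exact: lerD.
Qed.

(** The order interval between [0] and [I] is bounded: coordinates are linear
    in the entries of the Gram matrix, which [Re_form_le] bounds, the imaginary
    parts being real parts at ['i v]. *)
Lemma psd_crd_bounded : exists B : R, forall P k,
  psd rho P -> psd rho (herm1 rho - P) -> `|crd P k| <= B.
Proof.
have [g gK] := choice (@herm_mx_surj _ _ rho).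
pose C (u : V) : R := qform (herm1 rho) u; pose e := vbasis {:V}.
have C0 u : 0 <= C u by have /psd_qform := psd1; apply.
pose D (i j : 'I_n) := (C e`_i + C e`_j) + (C e`_i + C ('i%C *: e`_j)).
pose L k (i j : 'I_n) := `|crd (g (delta_mx i j)) k|.
exists (\sum_k \sum_(i < n) \sum_(j < n) D i j * L k i j) => P k P0 P1.
have D0 k' (i j : 'I_n) : 0 <= D i j * L k' i j.
  by apply: mulr_ge0; [apply: addr_ge0; apply: addr_ge0;
    exact: C0|exact: normr_ge0].
rewrite (bigD1 k) //=; apply: ler_wpDr.
  by do 3![apply: sumr_ge0 => ? _].
have -> : P = \sum_(i < n) \sum_(j < n) herm_mx P i j *: g (delta_mx i j).
  apply: herm_mx_inj; rewrite [LHS]matrix_sum_delta linear_sum.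
  apply: eq_bigr => i _; rewrite linear_sum; apply: eq_bigr => j _.
  by rewrite linearZ /= gK.
rewrite /crd linear_sum; apply: le_trans (ler_norm_sum _ _ _) _.
apply: ler_sum => i _; rewrite linear_sum;
  apply: le_trans (ler_norm_sum _ _ _) _.
apply: ler_sum => j _; rewrite linearZ /= normrM ler_wpM2r // !mxE.
apply: le_trans (ler_normD _ _) _; apply: lerD; first exact: Re_form_le.
apply: le_trans (Re_form_le e`_i ('i%C *: e`_j) P0 P1).
rewrite linearZr_LR /=; case: (rho (P _) _) => x y /=.
by rewrite mul0r mulN1r opprK add0r.
Qed.

End PsdCone.

(** * Flags of semistable polynomials *)

Lemma perm_index_enum n (s : seq 'I_n) : uniq s -> size s = n ->
  perm_eq (index_enum (ordinal n)) s.
Proof.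
move=> us ss; apply: uniq_perm => //; first exact: index_enum_uniq.
move=> i; rewrite mem_index_enum; symmetry.
have [|_ E] := uniq_min_size us (fun j _ => mem_index_enum j); last first.
  by rewrite E mem_index_enum.
by rewrite ss -sum1_size sum1_card card_ord.
Qed.

Lemma sort_decreasing (R : realType) n (i0 : 'I_n) (x : 'I_n -> R) :
  exists s : seq 'I_n, [/\ uniq s, size s = n &
    forall j k, (j <= k < n)%N -> x (nth i0 s k) <= x (nth i0 s j)].
Proof.
pose r := relpre x >=%R.
have rt : total r by move=> i j; rewrite /r /= le_total.
have rtr : transitive r by move=> i j k /= ij jk; exact: le_trans jk ij.
have sz : size (index_enum (ordinal n)) = n.
  by rewrite -sum1_size sum1_card card_ord.
exists (sort r (index_enum (ordinal n))); split.
- by rewrite sort_uniq index_enum_uniq.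
- by rewrite size_sort.
move=> j k /andP[jk kn].
have := sorted_leq_nth rtr (fun i => lexx (x i)) i0 (sort_sorted rt
  (index_enum (ordinal n))).
by apply; rewrite // inE size_sort sz // (leq_ltn_trans jk).
Qed.

Section Flags.
Variables (R : realType) (V : vectType R[i]) (rho : {dot V for conjC}).
Local Open Scope complex_scope.
Variable G : pol (herm rho).
Local Notation n := (\dim {:V}).
Let d := pdeg G.
Let H := ptop G.
Implicit Types (P Q : herm rho) (U : {vspace V}) (s : seq 'I_n)
  (S : {set 'I_n}).

Definition head_set s k : {set 'I_n} := finset (fun i => i \in take k.+1 s).

Lemma card_head_set s k : uniq s -> (k < size s)%N -> #|head_set s k| = k.+1.
Proof.
move=> us ks; rewrite cardsE (card_uniqP _) ?take_uniq // size_takel //.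
Qed.

Lemma head_setS s j k : (j <= k)%N -> head_set s j \subset head_set s k.
Proof.
move=> jk; apply/fintype.subsetP => i; rewrite !inE => ij.
have := mem_take (n0 := j.+1) (s := take k.+1 s); apply.
by rewrite take_takel.
Qed.

Lemma basis_proj_head (v : n.-tuple V) s k : uniq s ->
  basis_proj rho v (head_set s k) =
    \sum_(i <- take k.+1 s) rank1 rho (tnth v i).
Proof.
move=> us; rewrite basis_projE big_uniq ?take_uniq //.
by apply: eq_bigl => i; rewrite inE.
Qed.

Hypothesis gG : garding_elliptic G.

Let KD := @psdD R V rho.
Let KZ := @psdZ R V rho.
Let Ke := psd1 rho.
Let Kunit := @psd_unit R V rho.

Lemma herm_mixed_form : mixed_form (psd rho) (herm1 rho) d (mixed G).
Proof. exact: garding_mixed_form. Qed.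

Let mf := herm_mixed_form.

Lemma subspace_rankP U j : (j <= d)%N -> (j <= subspace_rank H U)%N <->
  0 < mixed G (fill (herm1 rho) d (nseq j (orth_proj rho U))).
Proof.
move=> jd; have [v [S [vu ->]]] := adapted_basis rho U.
rewrite /subspace_rank /subspace_restr (orth_proj_basis_span S vu).
exact: (line_ptop_degreeP KD KZ Ke gG Kunit (psd_basis_proj S vu)
  (psd_basis_proj_le1 S vu) jd).
Qed.

Hypothesis n0 : (0 < n)%N.
Hypothesis semistable : forall U : {vspace V},
  (d%:R / n%:R : R) * (\dim U)%:R <= (subspace_rank H U)%:R.

Lemma mixed_basis_proj v S m : unitary_basis rho v -> (m < d)%N ->
  (m * n < d * #|S|)%N ->
  0 < mixed G (fill (herm1 rho) d (nseq m.+1 (basis_proj rho v S))).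
Proof.
move=> vu md mS; rewrite -orth_proj_basis_span //; apply/subspace_rankP => //.
rewrite -(ltr_nat R); apply: lt_le_trans (semistable _).
rewrite (dim_basis_span S vu) mulrAC ltr_pdivlMr ?ltr0n //.
by rewrite -!natrM ltr_nat.
Qed.

(** The flags will be treated through their closure, on which the [Q k] are
    only known to lie between [0] and [I] with trace at least [k + 1]. The
    trace is at most the number of positive eigenvalues, so [Q] dominates a
    positive multiple of a projection of rank at least [k + 1]. *)
Lemma mixed_trace w Q k m : unitary_basis rho w -> psd rho Q ->
  psd rho (herm1 rho - Q) -> k.+1%:R <= htrace w Q ->
  (m < d)%N -> (m * n < d * k.+1)%N ->
  0 < mixed G (fill (herm1 rho) d (nseq m.+1 Q)).
Proof.
move=> wu; have [v [vu [y ->]]] := herm_spectral Q.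
move=> /(psd_eigsum vu) y0 y1.
have {}y1 : psd rho (eigsum rho v
  (fun i => 1 - y i)) by rewrite -eigsumB -eigsum1.
move/(psd_eigsum vu): y1 => y1.
rewrite htrace_eigsum // => yk md mk.
have {}y1 i : y i <= 1 by rewrite -subr_ge0.
pose S : {set 'I_n} := finset (fun i => 0 < y i).
have kS : (k < #|S|)%N.
  rewrite -(ler_nat R); apply: le_trans yk _.
  rewrite -sum1_card natr_sum [leRHS]big_mkcond /=; apply: ler_sum => i _.
  by rewrite inE; case: ltP => // ; rewrite mulr1n.
(* As the eigenvalues are at most 1, their product bounds each from below. *)
pose c := \prod_(i in S) y i.
have c0 : 0 < c by apply: prodr_gt0 => i; rewrite inE.
have cy i : i \in S -> c <= y i.
  move=> iS; rewrite /c (bigD1 i) //= ler_piMr //.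
  by apply: prodr_ile1 => j _; rewrite y0 y1.
have Mc : 0 < mixed G (fill (herm1 rho) d (nseq m.+1
  (c *: basis_proj rho v S))).
  have cE : nseq m.+1 (c *: basis_proj rho v S) =
      [seq (fun=> c) i *: (fun=> basis_proj rho v S) i | i <- nseq m.+1 0%N].
    by rewrite map_nseq.
  rewrite /fill size_nseq cE (mixed_scale mf) map_nseq mulr_gt0 //.
    by apply: prodr_gt0.
  have := @mixed_basis_proj v S m vu md; rewrite /fill size_nseq; apply.
  by apply: leq_trans mk _; rewrite leq_mul2l kS orbT.
apply: lt_le_trans Mc _; rewrite /fill !size_nseq.
have Kc : psd rho (c *: basis_proj rho v S) by apply: psdZ (ltW c0) _;
  exact: psd_basis_proj.
apply: (mixed_mono mf).
- by rewrite !size_nseq.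
- by rewrite !size_nseq subnKC.
- exact: all_in_nseq.
- by apply: all_in_nseq; apply/(psd_eigsum vu).
- exact: all_in_nseq.
- rewrite size_nseq => i im; rewrite !nth_nseq im eigsumZ eigsumB.
  apply/(psd_eigsum vu) => j; rewrite subr_ge0.
  by have [jS|jS] := boolP (j \in S); rewrite ?mulr1 ?mulr0 // cy.
Qed.

Definition flag_value (Q : nat -> herm rho) : R :=
  mixed G [seq Q (level d n i) | i <- iota 0 d].

Lemma flag_value_gt0 w (Q : nat -> herm rho) : unitary_basis rho w ->
  (forall k, (k < n)%N -> psd rho (Q k)) ->
  (forall j k, (j <= k < n)%N -> psd rho (Q k - Q j)) ->
  (forall k, (k < n)%N -> psd rho (herm1 rho - Q k)) ->
  (forall k, (k < n)%N -> k.+1%:R <= htrace w (Q k)) ->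
  0 < flag_value Q.
Proof.
move=> wu Q0 Qm Q1 Qt; apply: (mixed_greedy mf) => //.
- exact: (mixed_unit_gt0 KD KZ Ke gG Kunit).
- by move=> k m kn md mk; apply: (mixed_trace wu _ _ (Qt k kn)); auto.
Qed.

Definition flag (v : n.-tuple V) s k := basis_proj rho v (head_set s k).

Lemma htrace_flag w v s k : unitary_basis rho w -> unitary_basis rho v ->
  uniq s -> (k < size s)%N -> htrace w (flag v s k) = k.+1%:R.
Proof.
move=> wu vu us ks; rewrite htrace_eigsum // -natr_sum; congr (_%:R).
rewrite -(card_head_set us ks) -sum1_card [RHS]big_mkcond.
by apply: eq_bigr => i _; case: (_ \in _).
Qed.

End Flags.

(** * Compactness of the set of flags *)

Lemma sum_continuous (T : topologicalType) (R : realType) (I : Type)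
    (r : seq I) (f : I -> T -> R) :
  (forall i, continuous (f i)) -> continuous (fun x => \sum_(i <- r) f i x).
Proof.
move=> fc; elim: r => [|i r IH].
  under eq_fun do rewrite big_nil; exact: cst_continuous.
under eq_fun do rewrite big_cons.
by move=> x; apply: continuousD; [exact: fc|exact: IH].
Qed.

Lemma closure_ge0 (T : topologicalType) (R : realType) (A : set T)
    (f : T -> R) : continuous f -> (forall x, A x -> 0 <= f x) ->
  forall x, closure A x -> 0 <= f x.
Proof.
move=> fc fA; have cl : closed (f @^-1` [set y | 0 <= y]).
  by apply: closed_comp => [x _|]; [exact: fc|exact: closed_ge].
move=> x Ax; move/closure_id: cl => E.
suff : (f @^-1` [set y | 0 <= y]) x by [].
by rewrite E; apply: closureS Ax.
Qed.

Section ContinuousWords.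
Variables (T : topologicalType) (R : realType) (W : vectType R) (K : set W).
Variables (e : W) (d : nat) (M : seq W -> R).
Hypothesis mf : mixed_form K e d M.

Lemma mixed_continuous (Q : nat -> T -> W) s w :
  (forall k j, continuous (fun x => crd (Q k x) j)) ->
  continuous (fun x => M ([seq Q k x | k <- s] ++ w)).
Proof.
move=> Qc; elim: s w => [|k s IH] w; first by move=> x /=; exact: cvg_cst.
pose b (j : 'I_(\dim {:W})) := (vbasis {:W})`_j.
have -> : (fun x => M ([seq Q k x | k <- k :: s] ++ w)) =
    (fun x => \sum_j crd (Q k x) j * M ([seq Q k x | k <- s] ++ b j :: w)).
  apply/funext => x /=; rewrite {1}[Q k x]crd_sum (mixed_sum mf).
  apply: eq_bigr => j _; rewrite (mixedZ mf); congr (_ * _).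
  by apply: (mixed_perm mf);
    rewrite perm_sym -cat_rcons -cats1 -catA perm_catCA.
apply: sum_continuous => j x; apply: continuousM; first exact: Qc.
exact: IH.
Qed.

End ContinuousWords.

Section FlagCompact.
Variables (R : realType) (V : vectType R[i]) (rho : {dot V for conjC}).
Local Open Scope complex_scope.
Variable G : pol (herm rho).
Local Notation n := (\dim {:V}).
Local Notation N := (\dim {:herm rho}).
Local Notation b := (vbasis {:herm rho}).
Let d := pdeg G.
Let H := ptop G.

Hypothesis d0 : (0 < d)%N.
Hypothesis gG : garding_elliptic G.
Hypothesis n0 : (0 < n)%N.
Hypothesis semistable : forall U : {vspace V},
  (d%:R / n%:R : R) * (\dim U)%:R <= (subspace_rank H U)%:R.

Let idx k : 'I_n := insubd (Ordinal n0) k.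

(** Points of a row space encode [n] Hermitian forms, in order to use the
    compactness criterion there. *)
Definition forms_of (x : 'rV[R]_(n * N)) k : herm rho :=
  \sum_(j < N) x 0 (mxvec_index (idx k) j) *: b`_j.

Lemma crd_forms_of x k j : crd (forms_of x k) j = x 0 (mxvec_index (idx k) j).
Proof. by rewrite /crd /forms_of coord_sum_free // (basis_free
  (vbasisP _)). Qed.

Definition code_of (Q : nat -> herm rho) : 'rV[R]_(n * N) :=
  mxvec (\matrix_(k < n, j < N) crd (Q k) j).

Lemma code_ofK Q k : (k < n)%N -> forms_of (code_of Q) k = Q k.
Proof.
move=> kn; rewrite [RHS]crd_sum; apply: eq_bigr => j _.
by rewrite mxvecE mxE /idx val_insubd kn.
Qed.

Lemma forms_of_continuous k j : continuous (fun x => crd (forms_of x k) j).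
Proof.
under eq_fun do rewrite crd_forms_of.
by move=> x; exact: coord_continuous.
Qed.

Lemma linear_continuous_forms (f : herm rho -> R) : linear_for *%R f ->
  forall k, continuous (fun x => f (forms_of x k)).
Proof.
move=> fl k; have fE P : f P = \sum_j crd P j * f b`_j.
  pose f' := GRing.isLinear.Build _ _ _ _ f fl.
  pose F : {scalar herm rho} := HB.pack f f'.
  rewrite {1}[P]crd_sum -[f]/(F : _ -> _) linear_sum; apply: eq_bigr => j _.
  by rewrite linearZ.
under eq_fun do rewrite fE.
apply: sum_continuous => j x; apply: continuousM;
  first exact: forms_of_continuous.
exact: cst_continuous.
Qed.

Definition flag_codes : set 'rV[R]_(n * N) :=
  [set x | exists v s, [/\ unitary_basis rho v, uniq s, size s = n
    & x = code_of (flag rho v s)]].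

Lemma flag_codes_closureP (f : 'rV[R]_(n * N) -> R) : continuous f ->
  (forall v s, unitary_basis rho v -> uniq s -> size s = n ->
    0 <= f (code_of (flag rho v s))) ->
  forall x, closure flag_codes x -> 0 <= f x.
Proof.
by move=> fc f0; apply: closure_ge0 => // x [v [s [vu us ss ->]]]; exact: f0.
Qed.

Lemma qform_linear u : linear_for *%R (fun P : herm rho => qform P u).
Proof. by move=> a P Q; rewrite qformD qformZ. Qed.

Lemma qformB P Q u : qform (P - Q : herm rho) u = qform P u - qform Q u.
Proof. by rewrite qformD -scaleN1r qformZ mulN1r. Qed.

Lemma flag_codes_psd (f : 'rV[R]_(n * N) -> herm rho) :
  (forall u, continuous (fun x => qform (f x) u)) ->
  (forall v s, unitary_basis rho v -> uniq s -> size s = n ->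
    psd rho (f (code_of (flag rho v s)))) ->
  forall x, closure flag_codes x -> psd rho (f x).
Proof.
move=> fc f0 x Tx; apply/psd_qform => u.
apply: (flag_codes_closureP (fc u)) Tx => v s vu us ss.
by have /psd_qform := f0 v s vu us ss; apply.
Qed.

Lemma compact_flag_codes : compact (closure flag_codes).
Proof.
have [B HB] := psd_crd_bounded rho.
apply: (@subclosed_compact _ _ [set x : 'rV[R]_(n * N) |
  forall i, `[- B, B]%classic (x ord0 i)]).
- exact: closed_closure.
- by apply: (@rV_compact R _ (fun=> `[- B, B]%classic)) => i;
    exact: segment_compact.
move=> x Tx i; case/mxvec_indexP: i => k j /=; rewrite in_itv /=.
have bnd v s : unitary_basis rho v -> uniq s -> size s = n ->
    - B <= code_of (flag rho v s) ord0 (mxvec_index k j) <= B.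
  move=> vu us ss; rewrite -ler_norml mxvecE mxE; apply: HB.
    exact: psd_basis_proj.
  exact: psd_basis_proj_le1.
have cc : continuous (fun y : 'rV[R]_(n * N) => y ord0 (mxvec_index k j)).
  by move=> y; exact: coord_continuous.
apply/andP; split; rewrite -subr_ge0.
  apply: (flag_codes_closureP (f :=
    fun y => y ord0 (mxvec_index k j) - - B)) Tx.
    by move=> y; apply: (@continuousB R R^o _ _ (cst (- B)) y (cc y));
      apply: cst_continuous.
  by move=> v s vu us ss; rewrite subr_ge0; case/andP: (bnd v s vu us ss).
apply: (flag_codes_closureP (f := fun y => B - y ord0 (mxvec_index k j))) Tx.
  by move=> y; apply: (@continuousB R R^o _ (cst B) _ y _ (cc y));
    apply: cst_continuous.
by move=> v s vu us ss; rewrite subr_ge0; case/andP: (bnd v s vu us ss).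
Qed.

(** The value is continuous and positive on the compact closure of the set of
    flags. *)
Lemma flag_value_lower_bound : exists2 mu : R, 0 < mu &
  forall v s, unitary_basis rho v -> uniq s -> size s = n ->
    mu <= flag_value G (flag rho v s).
Proof.
have mf := herm_mixed_form gG.
have [w [wu _]] := herm_spectral (herm1 rho).
pose F x := flag_value G (forms_of x).
have Fflag Q : F (code_of Q) = flag_value G Q.
  rewrite /F /flag_value; congr (mixed _ _); apply/eq_in_map => i.
  rewrite mem_iota => /andP[_ id]; apply: code_ofK.
  by rewrite /level ltn_divLR // mulnC ltn_pmul2l.
have Fc : continuous F.
  have -> : F = (fun x => mixed G
      ([seq forms_of x k | k <- [seq level d n i | i <- iota 0 d]] ++ [::])).
    by apply/funext => x; rewrite cats0 -map_comp.
  exact: (mixed_continuous mf forms_of_continuous).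
have T0 : closure flag_codes !=set0.
  exists (code_of (flag rho w (index_enum (ordinal n)))).
  apply: subset_closure; exists w, (index_enum (ordinal n)); split=> //.
    exact: index_enum_uniq.
  by rewrite -sum1_size sum1_card card_ord.
have [c cT cmin] := EVT_min_rV T0 compact_flag_codes (continuous_subspaceT Fc).
exists (F c) => [|v s vu us ss]; last first.
  rewrite -Fflag; apply: cmin; rewrite inE; apply: subset_closure.
  by exists v, s.
rewrite inE in cT; have qc u := linear_continuous_forms (qform_linear u).
apply: (flag_value_gt0 gG n0 semistable wu).
- move=> k kn; apply: (@flag_codes_psd (forms_of^~ k)) cT => [u|v s vu us ss].
    exact: qc.
  by rewrite code_ofK //; exact: psd_basis_proj.
- move=> j k /andP[jk kn].
  apply: (@flag_codes_psd
    (fun x => forms_of x k - forms_of x j)) cT => [u x|v s vu us ss].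
    rewrite (_ : (fun y => _) =
      (fun y => qform (forms_of y k) u - qform (forms_of y j) u)).
      exact: (@continuousB R R^o _ _ _ x (qc u k x) (qc u j x)).
    by apply/funext => y; rewrite qformB.
  rewrite !code_ofK //; last exact: leq_ltn_trans kn.
  by apply: psd_basis_proj_sub => //; exact: head_setS.
- move=> k kn.
  apply: (@flag_codes_psd
    (fun x => herm1 rho - forms_of x k)) cT => [u x|v s vu us ss].
    rewrite (_ : (fun y => _) =
      (fun y => qform (herm1 rho) u - qform (forms_of y k) u)).
      apply: (@continuousB R R^o _ (cst _) _ x _ (qc u k x));
        exact: cst_continuous.
    by apply/funext => y; rewrite qformB.
  by rewrite code_ofK //; exact: psd_basis_proj_le1.
- move=> k kn; rewrite -subr_ge0.
  apply: (flag_codes_closureP (f := fun x => htrace w (forms_of x k) - _)) cT.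
    have tc : continuous (fun x => htrace w (forms_of x k)).
      by apply: sum_continuous => a; exact: qc.
    by move=> x; apply: (@continuousB R R^o _ _ (cst _) x (tc x));
      apply: cst_continuous.
  move=> v s vu us ss; rewrite subr_ge0 code_ofK //.
  by rewrite htrace_flag // ss.
Qed.

End FlagCompact.

(** * Determinantal capacity *)

Section Capacity.
Variables (R : realType) (V : vectType R[i]) (rho : {dot V for conjC}).
Local Open Scope complex_scope.
Variable G : pol (herm rho).
Local Notation n := (\dim {:V}).
Let d := pdeg G.
Let H := ptop G.
Let a : R := d%:R / n%:R.
Implicit Types (P Q : herm rho) (U : {vspace V}).

Hypothesis d0 : (0 < d)%N.
Hypothesis gG : garding_elliptic G.
Hypothesis n0 : (0 < n)%N.

Let mf := herm_mixed_form gG.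

Lemma exponent_gt0 : 0 < a.
Proof. by rewrite divr_gt0 // ltr0n. Qed.

Lemma ptop_ge0 P : psd rho P -> 0 <= peval H P.
Proof.
move=> P0; rewrite -(@pmulrn_lge0 _ _ d`!) ?fact_gt0 // peval_ptop.
by apply: (mixed_ge0 mf); [rewrite size_nseq|exact: all_in_nseq].
Qed.

Lemma posdef_psd P : posdef rho P -> psd rho P.
Proof.
move=> P0 u; have [->|u0] := eqVneq u 0; last exact/ltW/P0.
by rewrite (linear0r rho).
Qed.

Lemma det_posdef P : posdef rho P -> 0 < det_rho P.
Proof.
have [v [vu [x ->]]] := herm_spectral P.
by move=> /(posdef_eigsum vu) x0; rewrite det_eigsum // prodr_gt0.
Qed.

Lemma det_psd P : psd rho P -> 0 <= det_rho P.
Proof.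
have [v [vu [x ->]]] := herm_spectral P.
by move=> /(psd_eigsum vu) x0; rewrite det_eigsum // prodr_ge0.
Qed.

Lemma psd_degenerate P : psd rho P -> posdef rho P \/ det_rho P = 0.
Proof.
have [v [vu [x ->]]] := herm_spectral P.
move=> /(psd_eigsum vu) x0; rewrite det_eigsum //.
have [p0|p0] := eqVneq (\prod_i x i) 0; first by right.
left; apply/(posdef_eigsum vu) => i; rewrite lt_neqAle x0 andbT eq_sym.
by move/prodf_neq0: p0; apply.
Qed.

(** On degenerate forms the bound is [0 <= H P], which always holds. *)
Lemma det_bounded_cap eta : det_bounded H a eta <-> (eta%:E <= cap_det H a)%E.
Proof.
split=> [He|He P P0].
  apply/ereal_infP => _ [P P0 <-]; rewrite lee_fin.
  by rewrite ler_pdivlMr ?powR_gt0 ?det_posdef //; apply: He; exact: posdef_psd.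
have [Ppos|->] := psd_degenerate P0; last first.
  by rewrite powR0 ?gt_eqF ?exponent_gt0 // mulr0; exact: ptop_ge0.
have : (eta%:E <= (peval H P / det_rho P `^ a)%:E)%E.
  by apply: le_trans He _; apply: ereal_inf_lbound; exists P.
by rewrite lee_fin ler_pdivlMr ?powR_gt0 ?det_posdef.
Qed.

Lemma cap_det_fin eta : (eta%:E <= cap_det H a)%E ->
  exists c : R, cap_det H a = c%:E.
Proof.
move=> He; have [v [vu [x xE]]] := herm_spectral (herm1 rho).
have e0 : posdef rho (herm1 rho) by rewrite (eigsum1 vu);
  apply/(posdef_eigsum vu).
have := @ereal_inf_lbound R [set
  (peval H P / det_rho P `^ a)%:E | P in posdef rho].
move=> /(_ (peval H (herm1 rho) / det_rho (herm1 rho) `^ a)%:E) lb.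
have {}lb : (cap_det H a <= (peval H (herm1 rho) / det_rho
  (herm1 rho) `^ a)%:E)%E.
  by apply: lb; exists (herm1 rho).
by move: He lb; case: (cap_det H a) => [c| |] //; exists c.
Qed.

Lemma flag_dominated v s (x : 'I_n -> R) i0 k : unitary_basis rho v -> uniq s ->
  size s = n -> (forall i, 0 <= x i) -> (k < n)%N ->
  (forall j k, (j <= k < n)%N -> x (nth i0 s k) <= x (nth i0 s j)) ->
  psd rho (eigsum rho v x - x (nth i0 s k) *: flag rho v s k).
Proof.
move=> vu us ss x0 kn xs; rewrite eigsumZ eigsumB; apply/(psd_eigsum vu) => i.
rewrite subr_ge0; have [iS|_] := boolP (i \in head_set s k); last first.
  by rewrite mulr0.
rewrite mulr1; rewrite inE in iS; have := iS => /(nthP i0)[j].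
rewrite size_takel ?ss // => jk; rewrite nth_take // => <-.
by apply: xs; rewrite -ltnS jk.
Qed.

(** [P] dominates [x_k Q_k] along the flag of its sorted eigenspaces, so
    [d! H P] is at least the value of the flag times a product of eigenvalues
    spread evenly over the levels. *)
Lemma semistable_det_bounded : (forall U,
  a * (\dim U)%:R <= (subspace_rank H U)%:R) ->
  exists2 eta : R, 0 < eta & det_bounded H a eta.
Proof.
move=> semistable.
have [mu mu0 mule] := flag_value_lower_bound d0 gG n0 semistable.
have f0 : 0 < (d`!)%:R :> R by rewrite ltr0n fact_gt0.
exists (mu / (d`!)%:R); first by rewrite divr_gt0.
move=> P P0; have [Ppos|->] := psd_degenerate P0; last first.
  by rewrite powR0 ?gt_eqF ?exponent_gt0 // mulr0; exact: ptop_ge0.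
rewrite mulrAC ler_pdivrMr // mulr_natr peval_ptop.
have [v [vu [x xE]]] := herm_spectral P; rewrite {}xE in P0 Ppos *.
move/(posdef_eigsum vu): Ppos => x0.
pose i0 := Ordinal n0; have [s [us ss xs]] := sort_decreasing i0 x.
pose y k := x (nth i0 s k); have y0 k : 0 < y k by exact: x0.
have lev i : (i < d)%N -> (level d n i < n)%N.
  by move=> id; rewrite /level ltn_divLR // mulnC ltn_pmul2l.
have -> : det_rho (eigsum rho v x) = expR (\sum_(0 <= k < n) ln (y k)).
  rewrite det_eigsum // expR_sum.
  have -> : \prod_i x i = \prod_(i <- s) x i.
    by apply: perm_big; exact: perm_index_enum.
  rewrite (big_nth i0) ss; apply: eq_bigr => k _.
  by rewrite lnK // posrE.
have prodE : \prod_(i <- iota 0 d) y (level d n i) =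
    expR (\sum_(0 <= i < d) ln (y (level d n i))).
  rewrite expR_sum /index_iota subn0.
  by apply: eq_bigr => i _; rewrite lnK ?posrE.
apply: (@le_trans _ _ ((\prod_(i <- iota 0 d) y (level d n i)) *
    flag_value G (flag rho v s))).
  rewrite prodE mulrC -expRM ler_pM ?expR_ge0 ?(ltW mu0) ?mule //.
  rewrite ler_expR /a mulrC mulrAC ler_pdivrMr ?ltr0n // [leRHS]mulrC.
  apply: level_average => // j k jk; rewrite ler_ln ?posrE //; exact: xs.
rewrite /flag_value -[X in mixed G X]cats0.
have -> : [seq flag rho v s (level d n i) | i <- iota 0 d] =
    [seq flag rho v s k | k <- [seq level d n i | i <- iota 0 d]].
  by rewrite -map_comp.
have -> : \prod_(i <- iota 0 d) y (level d n i) =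
    \prod_(k <- [seq level d n i | i <- iota 0 d]) y k.
  by rewrite big_map.
rewrite -(mixed_scale mf) -[nseq d _]cats0.
have ynth i : (i < d)%N ->
    nth 0 [seq y k *: flag rho v s k | k <- [seq level d n i | i <- iota 0 d]]
      i =
    y (level d n i) *: flag rho v s (level d n i).
  by move=> id; rewrite !(nth_map 0%N) ?size_map ?size_iota // nth_iota.
apply: (mixed_mono mf).
- by rewrite !size_map size_iota size_nseq.
- by rewrite !size_map size_iota addn0.
- move=> _ /mapP[k _ ->]; apply: psdZ; first exact: ltW.
  exact: psd_basis_proj.
- exact: all_in_nseq.
- by [].
- move=> i; rewrite !size_map size_iota => id; rewrite nth_nseq id ynth //.
  apply: flag_dominated => //; first by move=> j; exact: ltW.
  exact: lev.
Qed.

(** [H (I + t pi_U)] has degree [subspace_rank H U] in [t], while the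
    determinant of [I + t pi_U] is at least [t ^ dim U]. *)
Lemma det_bounded_semistable eta : 0 < eta -> det_bounded H a eta ->
  forall U, a * (\dim U)%:R <= (subspace_rank H U)%:R.
Proof.
move=> eta0 He U; have [v [S [vu UE]]] := adapted_basis rho U.
set r := subspace_rank H U; set k := \dim U.
have kS : k = #|S| by rewrite /k UE (dim_basis_span S vu).
rewrite /a mulrAC ler_pdivrMr ?ltr0n // -!natrM ler_nat.
rewrite leqNgt; apply/negP => rk.
pose p := line (herm1 rho) (orth_proj rho U) H.
have pr : (size p <= r.+1)%N by rewrite /r /subspace_rank -/p leqSpred.
have [C C0 HC] := horner_le_growth pr.
have low t : 1 <= t -> eta * (t ^+ k) `^ a <= C * t ^+ r.
  move=> t1; have t0 : 0 <= t by rewrite (le_trans _ t1).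
  apply: le_trans (HC t t1); rewrite horner_line UE (orth_proj_basis_span S vu).
  have -> : herm1 rho + t *: basis_proj rho v S =
      eigsum rho v (fun i => 1 + t * (i \in S)%:R).
    by apply: (eigsum_eq vu) => i;
      rewrite (eigsum1 vu) eigsumZ /= add_lfunE !eigsum_tnth
        // -scalerDl rmorphD.
  set x := fun i => _; have x0 i : 0 <= x i by rewrite addr_ge0 ?mulr_ge0.
  have xpsd : psd rho (eigsum rho v x) by exact/(psd_eigsum vu).
  apply: le_trans (He _ xpsd).
  rewrite ler_pM2l // det_eigsum //; apply: ge0_ler_powR.
  - exact/ltW/exponent_gt0.
  - by rewrite nnegrE exprn_ge0.
  - by rewrite nnegrE prodr_ge0.
  rewrite kS -prodr_const [leLHS]big_mkcond /=; apply: ler_prod => i _.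
  by rewrite /x; case: (i \in S);
    rewrite ?mulr1 ?mulr0 ?addr0 ?t0 ?ler01 /= ?lerDr ?ler01.
have pow t : 1 <= t -> eta ^+ n * t <= C ^+ n.
  move=> t1; have t0 : 0 < t by rewrite (lt_le_trans _ t1).
  have tk0 : 0 <= t ^+ k by rewrite exprn_ge0 // ltW.
  have := low t t1; rewrite -(@ler_pXn2r _ n) ?nnegrE //; last 2 first.
  - by rewrite mulr_ge0 ?powR_ge0 // ltW.
  - by rewrite mulr_ge0 ?exprn_ge0 // ltW.
  rewrite !exprMn -(@powR_mulrn _
    ((t ^+ k) `^ a)) ?powR_ge0 // -powRrM /a divfK ?pnatr_eq0 ?gtn_eqF //.
  rewrite powR_mulrn // -!exprM => le.
  have trn : 0 < t ^+ (r * n) by rewrite exprn_gt0.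
  rewrite -(ler_pM2r trn); apply: le_trans le.
  rewrite -mulrA -exprS; apply: ler_wpM2l; first by rewrite exprn_ge0 // ltW.
  by apply: ler_weXn2l; rewrite // [(k * d)%N]mulnC.
(* The bound [pow] on [t] fails at this value. *)
have eta_n : 0 < eta ^+ n by rewrite exprn_gt0.
have /pow : 1 <= 1 + C ^+ n / eta ^+ n.
  by rewrite lerDl divr_ge0 ?exprn_ge0 // ltW.
rewrite mulrDr mulr1 mulrCA divff ?gt_eqF // mulr1.
by apply/negP; rewrite -ltNge ltrDr.
Qed.

End Capacity.

(** * Convex hulls of finite sets *)

Section Separation.
Variable R : realType.

Lemma convexP n (C : set 'rV[R]_n) : @convex_set R 'rV[R]_n C <->
  forall x y t, C x -> C y -> 0 <= t <= 1 -> C (t *: x + (1 - t) *: y).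
Proof.
split=> [Cc x y t Cx Cy /andP[t0 t1]|Cc x y t].
  have := Cc x y (Itv01 t0 t1); rewrite !inE; exact.
rewrite !inE => Cx Cy; apply: (Cc x y t%:num) => //.
by apply/andP; split; [exact: ge0|exact: le1].
Qed.

(** Normalized partial sums, since the induction needs weights of arbitrary
    positive total. *)
Lemma convex_sum n (C : set 'rV[R]_n) (I : eqType) (r : seq I)
    (l : I -> R) (x : I -> 'rV[R]_n) :
  @convex_set R 'rV[R]_n C -> (forall i, i \in r -> C (x i)) ->
  (forall i, 0 <= l i) -> 0 < \sum_(i <- r) l i ->
  C ((\sum_(i <- r) l i)^-1 *: \sum_(i <- r) l i *: x i).
Proof.
move=> /convexP Cc Cx l0; elim: r Cx => [|i r IH] Cx;
  first by rewrite !big_nil ltxx.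
rewrite !big_cons; set L := \sum_(j <- r) l j; set y := \sum_(j <- r) _ => Lpos.
have Ci : C (x i) by apply: Cx; rewrite inE eqxx.
have L0 : 0 <= L by exact: sumr_ge0.
move: L0; rewrite le_eqVlt => /orP[/eqP L0|L0].
  have -> : y = 0.
    rewrite /y big_seq big1 // => j jr; rewrite (_ : l j = 0) ?scale0r //.
    have /eqP := L0; rewrite eq_sym psumr_eq0 // => /allP/(_ j jr)/eqP.
    by [].
  rewrite -L0 !addr0 scalerA mulVf ?scale1r //.
  by move: Lpos; rewrite -L0 addr0 => /gt_eqF ->.
pose t := l i / (l i + L).
have -> : (l i + L)^-1 *: (l i *: x i + y) = t *: x i + (1 - t) *: (L^-1 *: y).
  rewrite scalerDr scalerA mulrC; congr (_ + _); rewrite scalerA;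
    congr (_ *: _).
  by rewrite /t; field; rewrite !gt_eqF.
apply: Cc => //.
  by apply: IH => // j jr; apply: Cx; rewrite inE jr orbT.
by rewrite divr_ge0 ?(ltW Lpos) // ler_pdivrMr // mul1r lerDl ltW.
Qed.

(** The nearest point [y] of the hull to [p]: its coefficients minimize a
    continuous function on a simplex. If [y] were not [p], moving from [y]
    towards a point [x] that is not below [p] for the weight [p - y] would
    decrease the distance. *)
Lemma mem_convex_hull n (pts : seq 'rV[R]_n) (p : 'rV[R]_n) :
  (forall w : 'I_n -> R, exists2 x, x \in pts &
     \sum_c w c * p 0 c <= \sum_c w c * x 0 c) ->
  smallest (@convex_set R 'rV[R]_n) [set x | x \in pts] p.
Proof.
move=> sep; set m := size pts; pose x (i : 'I_m) := nth 0 pts i.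
pose y (l : 'rV[R]_m) := \sum_i l 0 i *: x i.
have yE l c : y l 0 c = \sum_i l 0 i * x i 0 c.
  by rewrite /y summxE; apply: eq_bigr => i _; rewrite mxE.
pose simplex : set 'rV[R]_m :=
  [set l | (forall i, 0 <= l 0 i) /\ \sum_i l 0 i = 1].
pose f (l : 'rV[R]_m) := \sum_c (y l 0 c - p 0 c) ^+ 2.
have lc i : continuous (fun l : 'rV[R]_m => l 0 i) by move=> l;
  exact: coord_continuous.
have fc : continuous f.
  apply: sum_continuous => c.
  have yc : continuous (fun l => y l 0 c).
    under eq_fun do rewrite yE.
    apply: sum_continuous => i u; apply: continuousM; first exact: lc.
    exact: cst_continuous.
  have dc : continuous (fun l => y l 0 c - p 0 c).
    by move=> z; apply: (@continuousB R R^o _ _ (cst _) z (yc z));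
      apply: cst_continuous.
  under eq_fun do rewrite expr2.
  by move=> z; exact: (@continuousM R _ _ _ z (dc z) (dc z)).
have scl : closed simplex.
  have -> : simplex =
    (\bigcap_i (fun l : 'rV[R]_m => l 0 i) @^-1` [set z | 0 <= z])
      `&` (fun l => \sum_i l 0 i) @^-1` [set z | z = 1].
    apply/seteqP; split=> l [l0 l1]; split=> //; first by move=> i _; exact: l0.
    by move=> i; exact: l0.
  apply: closedI; first (apply: closed_bigI => i _).
    by apply: closed_comp => [l _|]; [exact: lc|exact: closed_ge].
  apply: closed_comp => [l _|]; last exact: closed_eq.
  by apply: sum_continuous => i; exact: lc.
have sc : compact simplex.
  apply: (@subclosed_compact _ _ [set l : 'rV[R]_m |
    forall i, `[0, 1]%classic (l ord0 i)]) => //.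
    by apply: (@rV_compact R _ (fun=> `[0, 1]%classic)) => i;
      exact: segment_compact.
  move=> l [l0 l1] i /=; rewrite in_itv /= l0 -l1 (bigD1 i) //= lerDl.
  by apply: sumr_ge0 => j _; exact: l0.
have [x0 x0p _] := sep (fun=> 0).
have m0 : (0 < m)%N by rewrite /m; case: (pts) x0p.
have s0 : simplex !=set0.
  exists (delta_mx 0 (Ordinal m0)); split=> [i|].
    by rewrite mxE eqxx ler0n.
  rewrite (bigD1 (Ordinal m0)) //= mxE !eqxx big1 ?addr0 // => i /negPf i0.
  by rewrite mxE i0 andbF.
have [l ls lmin] := EVT_min_rV s0 sc (continuous_subspaceT fc).
rewrite inE in ls; case: (ls) => l0 l1.
pose w c := p 0 c - y l 0 c.
have [xj xjp xjw] := sep w.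
pose j : 'I_m := Ordinal (etrans (index_mem xj pts) xjp : (index xj pts < m)%N).
have xjE : x j = xj by rewrite /x /= nth_index.
pose S := \sum_c w c ^+ 2; pose D := \sum_c (xj 0 c - y l 0 c) ^+ 2.
(* The point of the hull at proportion [t] from [y] to [xj] is not closer. *)
have var t : 0 < t -> t <= 1 -> 2 * S <= t * D.
  move=> t0 t1; pose lt' : 'rV[R]_m :=
    \row_i ((1 - t) * l 0 i + t * (i == j)%:R).
  have lts : simplex lt'.
    split=> [i|]; first by rewrite mxE addr_ge0 // mulr_ge0 ?subr_ge0 // ltW.
    under eq_bigr do rewrite mxE.
    rewrite big_split /= -!mulr_sumr l1 (bigD1 j) //= eqxx big1 ?addr0.
      by rewrite !mulr1 subrK.
    by move=> i /negPf ->.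
  have ltE c : y lt' 0 c = (1 - t) * y l 0 c + t * xj 0 c.
    rewrite !yE; under eq_bigr do rewrite mxE mulrDl.
    rewrite big_split /= mulr_sumr; congr (_ + _).
      by apply: eq_bigr => i _; rewrite mulrA.
    rewrite (bigD1 j) //= eqxx mulr1 xjE big1 ?addr0 // => i /negPf ->.
    by rewrite mulr0 mul0r.
  have := lmin lt'; rewrite inE => /(_ lts).
  have -> : f l = S by apply: eq_bigr => c _; rewrite /w -sqrrN opprB.
  have -> : f lt' = S - 2 * t * (\sum_c w c * (xj 0 c - y l 0 c)) + t ^+ 2 * D.
    rewrite /f /S /D !mulr_sumr -sumrB -big_split; apply: eq_bigr => c _ /=.
    by rewrite ltE /w; ring.
  have SD : S <= \sum_c w c * (xj 0 c - y l 0 c).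
    rewrite -subr_ge0 /S -sumrB.
    have -> : \sum_c (w c * (xj 0 c - y l 0 c) - w c ^+ 2) =
        \sum_c w c * xj 0 c - \sum_c w c * p 0 c.
      by rewrite -sumrB; apply: eq_bigr => c _; rewrite /w; ring.
    by rewrite subr_ge0.
  set T := \sum_c _ in SD *; move=> le.
  have : t * (2 * S) <= t * (t * D) by nra.
  by rewrite ler_pM2l.
have S0 : S = 0.
  apply/eqP; rewrite eq_le sumr_ge0 ?andbT; last by move=> c _; exact: sqr_ge0.
  rewrite leNgt; apply/negP => Spos.
  have D2 : 2 * S <= D by have := var 1 ltr01 (lexx 1); rewrite mul1r.
  have Dpos : 0 < D by lra.
  have : 2 * S <= S / D * D.
    by apply: var; rewrite ?divr_gt0 // ler_pdivrMr //; lra.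
  by rewrite divfK ?gt_eqF //; lra.
have -> : p = y l.
  apply/rowP => c; apply/eqP; rewrite -subr_eq0 -sqrf_eq0; apply/eqP.
  by apply: (psumr_eq0P _ S0) => // k _; exact: sqr_ge0.
move=> C [Cc Cp]; have := @convex_sum _ C _ (index_enum (ordinal m)) (l 0) x Cc.
rewrite l1 invr1 scale1r; apply=> // i _.
by apply: Cp; exact: mem_nth.
Qed.

End Separation.

(** * Newton polytopes of unitary restrictions *)

Section Newton.
Variables (R : realType) (V : vectType R[i]) (rho : {dot V for conjC}).
Local Open Scope complex_scope.
Variable G : pol (herm rho).
Local Notation n := (\dim {:V}).
Let d := pdeg G.
Let H := ptop G.
Let a : R := d%:R / n%:R.
Implicit Types (P Q : herm rho) (U : {vspace V}) (l : seq 'I_n).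

Hypothesis d0 : (0 < d)%N.
Hypothesis gG : garding_elliptic G.
Hypothesis n0 : (0 < n)%N.

Let mf := herm_mixed_form gG.

Lemma psd_rank1 (v : V) : psd rho (rank1 rho v).
Proof.
move=> u; rewrite rank1E linearZl_LR /= (hermC rho v) expr0 mul1r.
exact: mul_conjC_ge0.
Qed.

Lemma sum_word (w : 'I_n -> R) l :
  \sum_c w c * (word_mnm l c)%:R = \sum_(i <- l) w i.
Proof.
elim: l => [|i l IH].
  by rewrite big_nil big1 // => c _; rewrite mnmE mulr0.
rewrite big_cons -IH [w i](_ : _ = \sum_c w c * (i == c)%:R).
  rewrite -big_split; apply: eq_bigr => c _.
  by rewrite !mnmE /= natrD mulrDr.
rewrite (bigD1 i) //= eqxx mulr1 big1 ?addr0 // => c /negPf.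
by rewrite eq_sym => ->; rewrite mulr0.
Qed.

Lemma mem_msupp_word (v : n.-tuple V) l : size l = d ->
  0 < mixed G [seq rank1 rho (tnth v i) | i <- l] ->
  word_mnm l \in msupp (basis_restr v H).
Proof.
move=> ld Ml; have [c c0] := mcoeff_restr (fun i => rank1 rho (tnth v i)) H l.
rewrite pderivs_ptop ?size_map // -/(mixed _ _) => E.
rewrite mcoeff_msupp; apply/eqP => H0.
by move: Ml; rewrite -E [X in X *+ c](_ : _ = 0) ?mul0rn ?ltxx.
Qed.

Lemma msupp_word (v : n.-tuple V) m : m \in msupp (basis_restr v H) ->
  exists l, [/\ word_mnm l = m, size l = d &
    0 < mixed G [seq rank1 rho (tnth v i) | i <- l]].
Proof.
move=> mH; have [l lm] := word_mnmP m; exists l; rewrite lm.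
have [c c0] := mcoeff_restr (fun i => rank1 rho (tnth v i)) H l.
rewrite lm => E; pose u := [seq rank1 rho (tnth v i) | i <- l].
have u0 : peval (pderivs u H) 0 != 0.
  rewrite /u -E mulrn_eq0 negb_or -lt0n c0 /=.
  by rewrite mcoeff_msupp in mH.
have Hd : homog d H by exact: homog_ptop.
have ld : size l = d.
  have su : size u = size l by rewrite size_map.
  case: (ltngtP (size l) d) => // ld; exfalso; move/eqP: u0; apply.
    apply: (@peval_homog0 _ _ (d - size l).-1); rewrite prednK ?subn_gt0 //.
    by apply: homog_pderivs; rewrite su subnKC // ltnW.
  have -> : pderivs u H = 0; last by rewrite /peval meval0.
  apply: deg_lt0; apply: deg_lt_pderivs; rewrite addn0 su => k dk.
  by apply: Hd; rewrite gtn_eqF // (leq_trans ld).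
split=> //; rewrite lt_neqAle eq_sym; apply/andP; split.
  by move: u0; rewrite pderivs_ptop // size_map.
apply: (mixed_ge0 mf); first by rewrite size_map.
by move=> _ /mapP[i _ ->]; exact: psd_rank1.
Qed.

(** By [mem_convex_hull] an exponent is needed for each weight [w]. Expanding
    the greedy word of the flag sorted by [w] replaces a letter of level [k] by
    one of the [k + 1] heaviest basis vectors, so the exponent weighs at least
    as much as the evenly spread levels. *)
Lemma semistable_newton (v : n.-tuple V) :
  (forall U, a * (\dim U)%:R <= (subspace_rank H U)%:R) ->
  unitary_basis rho v -> newton (basis_restr v H) (const_mx a).
Proof.
move=> semistable vu; rewrite /newton.
pose row (m : multinom n) : 'rV[R]_n := \row_i (m i)%:R.
have -> : [set \row_(i < n) (m i)%:R | m in [set` msupp (basis_restr v H)]] =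
    [set x | x \in map row (msupp (basis_restr v H))].
  apply/seteqP; split=> [_ [m mH <-]|x /mapP[m mH ->]]; last by exists m.
  exact: map_f.
apply: mem_convex_hull => w.
pose i0 := Ordinal n0; have [s [us ss ws]] := sort_decreasing i0 w.
have [mu mu0 mule] := flag_value_lower_bound d0 gG n0 semistable.
have lev i : (i < d)%N -> (level d n i < n)%N.
  by move=> id; rewrite /level ltn_divLR // mulnC ltn_pmul2l.
pose lv := [seq level d n i | i <- iota 0 d].
have : 0 < mixed G ([seq \sum_(i <- take k.+1 s) rank1 rho
  (tnth v i) | k <- lv] ++ [::]).
  apply: lt_le_trans mu0 _; apply: le_trans (mule v s vu us ss) _.
  rewrite /flag_value cats0 /lv -map_comp le_eqVlt; apply/orP; left; apply/eqP.
  by congr (mixed _ _); apply: eq_map => k /=; rewrite /flag basis_proj_head.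
move=> /(mixed_select mf)[l [ls Ml ll]]; rewrite cats0 in Ml.
have ld : size l = d by rewrite ls size_map size_iota.
exists (row (word_mnm l)); first exact/map_f/mem_msupp_word.
have -> : \sum_c w c * (row (word_mnm l)) 0 c = \sum_(i <- l) w i.
  by rewrite -(sum_word w l); apply: eq_bigr => c _; rewrite mxE.
apply: (@le_trans _ _ (\sum_(k <- lv) w (nth i0 s k))).
  have -> : \sum_c w c * (const_mx a : 'rV[R]_n) 0 c =
      a * \sum_(0 <= k < n) w (nth i0 s k).
    under eq_bigr do rewrite mxE.
    rewrite -mulr_suml mulrC; congr (_ * _).
    have -> : \sum_i w i = \sum_(i <- s) w i; last by rewrite (big_nth i0) ss.
    by apply: perm_big; exact: perm_index_enum.
  rewrite /lv big_map /a mulrAC ler_pdivrMr ?ltr0n // [leRHS]mulrC.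
  have := @level_average R d n (fun k => w (nth i0 s k)) d0 ws.
  by rewrite /index_iota !subn0.
have lvn k : k \in lv -> (k < n)%N.
  by case/mapP => i; rewrite mem_iota => /andP[_ id] ->; exact: lev.
move: ll lvn; move: (lv) => t; clear -ws us ss;
  elim: t l => [|k t IH] [|i l] //=.
  by rewrite !big_nil.
move=> /andP[ik lt] tn; rewrite !big_cons; apply: lerD; last first.
  by apply: IH => // j jt; apply: tn; rewrite inE jt orbT.
have kn : (k < n)%N by apply: tn; rewrite inE eqxx.
have := ik => /(nthP i0)[j]; rewrite size_takel ?ss // => jk.
by rewrite nth_take // => <-; apply: ws; rewrite -ltnS jk.
Qed.

(** In a basis adapted to [U], all exponents lie in the half-space where the
    coordinates of [U] have sum at most [subspace_rank H U]. *)
Lemma newton_semistable :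
  (forall v : n.-tuple V, unitary_basis rho v ->
     newton (basis_restr v H) (const_mx a)) ->
  forall U, a * (\dim U)%:R <= (subspace_rank H U)%:R.
Proof.
move=> Hn U; have [v [S [vu UE]]] := adapted_basis rho U.
pose C : set 'rV[R]_n :=
  [set x | \sum_(i in S) x 0 i <= (subspace_rank H U)%:R].
have Cc : @convex_set R 'rV[R]_n C.
  apply/convexP => x y t Cx Cy /andP[t0 t1].
  rewrite /C /=; under eq_bigr do rewrite !mxE.
  rewrite big_split /= -!mulr_sumr.
  set r := (subspace_rank H U)%:R in Cx Cy *.
  have -> : r = t * r + (1 - t) * r by ring.
  by apply: lerD; apply: ler_wpM2l; rewrite ?subr_ge0.
have CE : [set \row_(i < n) (m i)%:R | m in [set` msupp
  (basis_restr v H)]] `<=` C.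
  move=> _ [m /= mH <-]; rewrite /C /=.
  under eq_bigr do rewrite mxE.
  have [l [<- ld Ml]] := msupp_word mH.
  rewrite -natr_sum ler_nat.
  pose k := count (mem S) l.
  have -> : (\sum_(i in S) word_mnm l i)%N = k.
    rewrite /k; under eq_bigr do rewrite mnmE.
    elim: (l) => [|i l' IH]; first by rewrite big1.
    rewrite /= big_split /= IH; congr (_ + _)%N.
    rewrite big_mkcond (bigD1 i) //= eqxx big1 ?addn0; first by case: (i \in S).
    by move=> j /negPf; rewrite eq_sym => ->; case: ifP.
  have kd : (k <= d)%N by rewrite -ld; exact: count_size.
  apply/(subspace_rankP gG _ kd); rewrite UE (orth_proj_basis_span S vu).
  pose F i := if i \in S then basis_proj rho v S else herm1 rho.
  have KF i : psd rho (F i) by rewrite /F; case: ifP => _;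
    [exact: psd_basis_proj|exact: psd1].
  apply: lt_le_trans Ml _.
  have -> : mixed G (fill (herm1 rho) d (nseq k (basis_proj rho v S))) =
      mixed G ([seq F i | i <- l] ++ [::]).
    apply: (mixed_perm mf); rewrite cats0 /fill size_nseq.
    have -> : (d - k)%N = count (predC (mem S)) l.
      by rewrite -ld -(count_predC (mem S) l) addKn.
    rewrite /k; elim: (l) => //= i l' IH; case iS: (i \in S).
      by rewrite /F iS -/F /nat_of_bool add1n add0n /= perm_cons.
    rewrite /F iS -/F /nat_of_bool add1n add0n /=.
    by rewrite -cat_rcons -cats1 -catA perm_catCA /= perm_cons.
  rewrite -[X in mixed G X]cats0; apply: (mixed_mono mf).
  - by rewrite !size_map.
  - by rewrite size_map addn0.
  - by move=> _ /mapP[i _ ->]; exact: psd_rank1.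
  - by move=> _ /mapP[i _ ->].
  - by [].
  rewrite size_map => i il.
  rewrite !(nth_map (Ordinal n0)) //; set j := nth _ l i.
  have jE : rank1 rho (tnth v j) = basis_proj rho v (finset.set1 j).
    by rewrite basis_projE big_set1.
  rewrite jE /F; case: ifP => jS; last exact: psd_basis_proj_le1.
  by apply: psd_basis_proj_sub => //; rewrite finset.sub1set.
have := Hn v vu C (conj Cc CE); rewrite /C /=.
under eq_bigr do rewrite mxE.
by rewrite sumr_const UE (dim_basis_span S vu) mulr_natr.
Qed.

End Newton.

(** * Det-ellipticity and slope semistability *)

Section Ellipticity.
Variables (R : realType) (V : vectType R[i]) (rho : {dot V for conjC}).
Local Open Scope complex_scope.
Variable G : pol (herm rho).
Local Notation n := (\dim {:V}).
Let d := pdeg G.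
Let H := ptop G.
Let a : R := d%:R / n%:R.
Let A : set (herm rho) := interior (ray_component1 (psd rho) G).
Implicit Types (P Q : herm rho) (U : {vspace V}).

Hypothesis d0 : (0 < d)%N.
Hypothesis gG : garding_elliptic G.

Let KD := @psdD R V rho.
Let KZ := @psdZ R V rho.
Let Ke := psd1 rho.
Let Kunit := @psd_unit R V rho.

(** On the zero space [I] is zero, so its mixed value is. *)
Lemma space_nontrivial : (0 < n)%N.
Proof.
rewrite lt0n; apply/negP => /eqP V0.
have mf := herm_mixed_form gG.
have := mixed_unit_gt0 KD KZ Ke gG Kunit; rewrite -/d -(prednK d0) /=.
have -> : herm1 rho = 0 *: herm1 rho.
  apply/val_inj/lfunP => u; have : u \in fullv by exact: memvf.
  move/eqP: V0; rewrite dimv_eq0 => /eqP ->; rewrite memv0 => /eqP ->.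
  by rewrite !linear0.
by rewrite (mixedZ mf) mul0r ltxx.
Qed.

Let n0 := space_nontrivial.

Lemma det_scale (t : R) P : det_rho (t *: P) = t ^+ n * det_rho P.
Proof.
have [v [vu [x ->]]] := herm_spectral P.
by rewrite eigsumZ !det_eigsum // big_split prodr_const card_ord.
Qed.

(** Compare leading coefficients in [t] in the inequality for [t P]. *)
Lemma det_elliptic_bounded eta : det_elliptic G A a eta -> det_bounded H a eta.
Proof.
move=> He P P0; have [B AB] := interior_ray_component1 KD KZ Ke Kunit gG.
pose c := eta * det_rho P `^ a.
pose p := line B P G - (peval G B)%:P - c *: 'X^d.
have size_p : (size p <= d.+1)%N.
  rewrite (leq_trans (size_polyD _ _)) // geq_max size_polyN.
  rewrite (leq_trans (size_scale_leq _ _)) ?size_polyXn // andbT.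
  rewrite (leq_trans (size_polyD _ _)) // geq_max size_polyN.
  by rewrite (leq_trans (size_polyC_leq1 _)) // andbT;
    apply/size_line/deg_lt_pdeg.
suff : 0 <= p`_d.
  rewrite !coefB coefC coefZ coefXn eqxx mulr1 gtn_eqF // subr0 subr_ge0.
  by rewrite coef_line_top.
apply: coef_ge0_growth => // t t1; have t0 : 0 <= t by rewrite (le_trans _ t1).
rewrite !hornerE horner_line subr_ge0.
have -> : c * t ^+ d = eta * det_rho (t *: P) `^ a.
  rewrite det_scale powRM ?exprn_ge0 ?det_psd // -(powR_mulrn n t0) -powRrM.
  have -> : n%:R * a = d%:R by rewrite /a mulrC divfK // pnatr_eq0 gtn_eqF.
  by rewrite powR_mulrn // /c -mulrA [X in eta * X]mulrC.
exact: He (psdZ t0 P0).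
Qed.

Lemma det_bounded_elliptic eta : det_bounded H a eta -> det_elliptic G A a eta.
Proof.
move=> He B P AB P0; apply: le_trans (He P P0) _.
apply: (ptop_le_increment gG) => //; exact: interior_subset AB.
Qed.

Lemma det_ellipticP eta : det_elliptic G A a eta <-> (eta%:E <= cap_det H a)%E.
Proof.
split=> [/det_elliptic_bounded/(det_bounded_cap d0 gG n0)//|].
by move/(det_bounded_cap d0 gG n0); exact: det_bounded_elliptic.
Qed.

(** On the whole space the inequality is an equality, as [H] does not vanish at
    [I]. *)
Lemma slope_semistableP : slope_semistable H d <->
  forall U, a * (\dim U)%:R <= (subspace_rank H U)%:R.
Proof.
have slopeE U : (0 < \dim U)%N -> (slope H U <= (n%:R / d%:R)%:E)%E =
    (a * (\dim U)%:R <= (subspace_rank H U)%:R).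
  move=> U0; rewrite /slope; case: eqP => [->|/eqP r0].
    by rewrite leye_eq /=; apply/esym/negbTE;
      rewrite -ltNge mulr_gt0 ?ltr0n // exponent_gt0.
  have rpos : 0 < (subspace_rank H U)%:R :> R by rewrite ltr0n lt0n.
  rewrite lee_fin ler_pdivrMr // [X in _ =
    (X <= _)]mulrAC ler_pdivrMr ?ltr0n //.
  by rewrite mulrAC ler_pdivlMr ?ltr0n // [in LHS]mulrC [n%:R * _]mulrC.
split=> ss U; last by move=> U0 _; rewrite slopeE ?ss // lt0n dimv_eq0.
have [->|U0] := eqVneq U 0%VS; first by rewrite dimv0 mulr0.
have [->|UV] := eqVneq U fullv; last by rewrite -slopeE ?ss // lt0n dimv_eq0.
rewrite divfK ?pnatr_eq0 ?gtn_eqF // ler_nat; apply/subspace_rankP => //.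
have -> : orth_proj rho fullv = herm1 rho.
  apply/val_inj/lfunP => u; rewrite /= id_lfunE.
  by apply: daddv_pi_id; [exact: orthov_cap|exact: memvf].
rewrite /fill size_nseq subnn cats0.
exact: (mixed_unit_gt0 KD KZ Ke gG Kunit).
Qed.

End Ellipticity.

Theorem theorem1p2 (R : realType) (V : vectType R[i]) (rho : {dot V for conjC})
    (n d : nat) (G : pol (herm rho)) :
  \dim {:V} = n -> (1 <= d)%N -> pdeg G = d -> garding_elliptic G ->
  let H := ptop G in
  let A : set (herm rho) := interior (ray_component1 (psd rho) G) in
  let a : R := d%:R / n%:R in
  [<-> exists eta : R, 0 < eta /\ det_elliptic G A a eta;
       exists eta : R, 0 < eta /\ det_bounded H a eta;
       (0%:E < cap_det H a)%E;
       forall v : n.-tuple V, unitary_basis rho v ->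
         newton (basis_restr v H) (const_mx a);
       slope_semistable H d;
       forall U : {vspace V}, a * (\dim U)%:R <= (subspace_rank H U)%:R]
  /\ ((exists eta : R, 0 < eta /\ det_elliptic G A a eta) ->
      exists c : R,
        [/\ cap_det H a = c%:E,
            largest [set eta : R | 0 < eta /\ det_elliptic G A a eta] c
          & largest [set eta : R | 0 < eta /\ det_bounded H a eta] c]).
Proof.
move=> <- + dG gG; rewrite -dG => d0 H A a.
have n0 := space_nontrivial d0 gG.
have bnd := @det_bounded_cap _ _ _ _ d0 gG n0.
have ell := @det_ellipticP _ _ _ _ d0 gG.
have stable_bnd eta : 0 < eta -> det_bounded H a eta ->
    forall U : {vspace V}, a * (\dim U)%:R <= (subspace_rank H U)%:R.
  exact: det_bounded_semistable.
have slp := slope_semistableP d0 gG.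
split.
  tfae.
  - by move=> [eta [eta0 /ell/bnd He]]; exists eta.
  - by move=> [eta [eta0 /bnd He]]; apply: lt_le_trans He; rewrite lte_fin.
  - move=> cap0 v vu; apply: semistable_newton => //.
    have [eta eta0 He] : exists2 eta : R, 0 < eta & (eta%:E <= cap_det H a)%E.
      move: cap0; case: (cap_det H a) => [c| |] //; first by exists c.
      by exists 1; rewrite ?leey.
    by apply: (stable_bnd eta) => //; exact/bnd.
  - by move=> Hn; apply/slp/newton_semistable.
  - by move/slp.
  - move=> ss; have [eta eta0 He] := semistable_det_bounded d0 gG n0 ss.
    by exists eta; split=> //; exact/ell/bnd.
move=> [eta [eta0 /ell He]]; have [c cE] := cap_det_fin He.
have ec x : (x%:E <= cap_det H a)%E = (x <= c) by rewrite cE lee_fin.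
have c0 : 0 < c by rewrite (lt_le_trans eta0) // -ec.
exists c; split=> //; split.
- by split=> //; apply/ell; rewrite ec.
- by move=> x [_ /ell]; rewrite ec.
- by split=> //; apply/bnd; rewrite ec.
- by move=> x [_ /bnd]; rewrite ec.
Qed.
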